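(* Let $\mathcal E$ be a discrete asymmetric information economy with commodity space a Banach lattice $Y$ and let $\mathcal E_c$ be the associated continuum economy. Assume: (Continuity) for all $i\in N$, $\omega\in\Omega$, $U_i(\omega,\cdot)$ is norm-continuous on $Y_+$; (Monotonicity) for all $i\in N$, $\omega\in\Omega$, if $x,y\in Y_+$ and $y>0$ then $U_i(\omega,x+y)>U_i(\omega,x)$; (Concavity) for all $i\in N$, $\omega\in\Omega$, $U_i(\omega,\cdot)$ is concave; (Positivity) for each $\omega\in\Omega$, $\sum_{i\in N}a_i(\omega)>0$; (Stability) there is $\hat a\in Y_+$ such that $L\left(\sum_{i\in N}a_i(\omega)\right)=L(\hat a)$ for each $\omega\in\Omega$; (Strong properness) if $(x_1,\dots,x_n)$ is a privately Pareto optimal allocation in $\mathcal E$, then for each $i\in N$ the preference relation $P_i$ is strongly ATY-proper at $x_i$. Let $f$ be a feasible allocation in $\mathcal E_c$ such that $f(t,\cdot)=x_i$ for all $t\in I_i$ and $i\in N$. If $f$ is in the private core of $\mathcal E_c$, then $(f,\pi)$ is a non-trivial Walrasian expectations quasi-equilibrium of $\mathcal E_c$ for some non-zero $\pi:\Omega\to Y_+^*$.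
   Context: **Discrete economy.** $N=\{1,\dots,n\}$ is a finite set of agents; $(\Omega,\mathcal F)$ is a measurable space with $\Omega$ a finite set of states, the $\sigma$-algebra $\mathcal F$ being the set of all events; $Y$ is a Banach lattice with positive cone $Y_+$, norm dual $Y^*$, and positive dual cone $Y_+^*$. For $y\in Y$, $y>0$ means $y\ge 0$ and $y\neq 0$. For an element $y$ of a Banach lattice $X$, the principal ideal of $y$ is $L(y)=\{z\in X: |z|\le m|y| \text{ for some } m\in\mathbb N\}$; this is used both for $X=Y$ and for $X=Y^\Omega$ (with pointwise order and product norm). A discrete economy $\mathcal E$ consists, for each $i\in N$, of a partition $\mathcal F_i$ of $\Omega$ (private information), a random utility $U_i:\Omega\times Y_+\to\mathbb R$, a random initial endowment $a_i:\Omega\to Y_+$ that is constant on elements of $\mathcal F_i$, and a prior $q_i$, a probability measure on $\Omega$ with $q_i(\omega)>0$ for all $\omega$. The ex ante expected utility is $V_i(x)=\sum_{\omega\in\Omega}U_i(\omega,x(\omega))q_i(\omega)$ for $x:\Omega\to Y_+$. A function on $\Omega$ is called $\mathcal F_i$-measurable if it is constant on elements of $\mathcal F_i$ (measurability is meant with respect to the $\sigma$-algebra generated by the partition); $L_i=\{x\in (Y_+)^\Omega: x \text{ is } \mathcal F_i\text{-measurable}\}$. An allocation of $\mathcal E$ is $x=(x_1,\dots,x_n)$ with $x_i\in L_i$; it is feasible if $\sum_i x_i(\omega)\le\sum_i a_i(\omega)$ for all $\omega$. A feasible allocation $x$ is privately Pareto optimal if there is no feasible allocation $y$ with $V_i(y_i)>V_i(x_i)$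 for all $i\in N$. **Preferences.** For $x_i\in L_i$, $P_i(x_i)=\{y_i\in L_i:V_i(y_i)>V_i(x_i)\}$. $P_i$ is strongly ATY-proper at $x_i\in L_i$ if there is a convex set $\widehat P_i(x_i)\subseteq Y^\Omega$ with non-empty interior in the product norm topology of $Y^\Omega$ such that $\widehat P_i(x_i)\cap L_i=P_i(x_i)$ and $(\operatorname{int}\widehat P_i(x_i))\cap L_i\cap L(\sum_{i\in N}a_i)\neq\emptyset$, where $L(\sum_{i\in N}a_i)$ is the principal ideal of $\sum_{i\in N}a_i$ in $Y^\Omega$. **Price systems and budget sets.** A price system is an $\mathcal F$-measurable non-zero function $\pi:\Omega\to Y_+^*$, and $B_i(\pi)=\{x\in L_i:\sum_{\omega}\langle\pi(\omega),x(\omega)\rangle\le\sum_{\omega}\langle\pi(\omega),a_i(\omega)\rangle\}$. **Continuum economy $\mathcal E_c$.** The agent space is $I=[0,1]$ with Lebesgue measure $\mu$, $I_i=[\frac{i-1}{n},\frac in)$ for $i<n$ and $I_n=[\frac{n-1}{n},1]$. Each $t\in I_i$ has $L_t=L_i$, $a(t,\cdot)=a_i$, $V_t=V_i$, $B_t(\pi)=B_i(\pi)$. Integrals of $Y$-valued functions are Bochner integrals. An assignment is $f:I\times\Omega\to Y_+$ with $f(\cdot,\omega)$ Bochner integrable for every $\omega$; it is an allocation if $f(t,\cdot)\in L_t$ for almost all $t$; an allocation is feasible if $\int_I f(t,\omega)d\mu(t)\le\int_I a(t,\omega)d\mu(t)$ for all $\omega$. A coalition is a Borel measurable set $S\subseteq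 I$ with $\mu(S)>0$. It privately blocks an allocation $f$ if there is $g:S\times\Omega\to Y_+$ with $g(t,\cdot)\in L_t$ and $V_t(g(t,\cdot))>V_t(f(t,\cdot))$ for all $t\in S$ and $\int_S g(t,\omega)d\mu(t)\le\int_S a(t,\omega)d\mu(t)$ for all $\omega$. The private core of $\mathcal E_c$ is the set of feasible allocations not privately blocked by any coalition. **Quasi-equilibrium of $\mathcal E_c$.** For a feasible allocation $f$ and price system $\pi$, $(f,\pi)$ is a Walrasian expectations quasi-equilibrium if (i) for all $t\in I$, $f(t,\cdot)\in B_t(\pi)$, and $f(t,\cdot)$ maximizes $V_t$ on $B_t(\pi)$ whenever $\sum_\omega\langle\pi(\omega),a(t,\omega)\rangle\ne 0$; and (ii) $\sum_\omega\langle\pi(\omega),\int_I f(t,\omega)d\mu(t)\rangle=\sum_\omega\langle\pi(\omega),\int_I a(t,\omega)d\mu(t)\rangle$. It is non-trivial if $\sum_\omega\langle\pi(\omega),a(t,\omega)\rangle\ne 0$ for all $t$ in some coalition. *)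

(* Defs.v *)
From HB Require Import structures.
From mathcomp Require Import all_boot all_order all_algebra.
From mathcomp Require Import all_classical all_reals all_analysis.

Set Implicit Arguments.
Unset Strict Implicit.
Unset Printing Implicit Defensive.

Import Order.TTheory GRing.Theory Num.Theory.
Import numFieldNormedType.Exports.

Local Open Scope classical_set_scope.
Local Open Scope ring_scope.

Reserved Notation "x <=L y" (at level 70, no associativity).
Reserved Notation "x <L y" (at level 70, no associativity).

(** * Banach lattices *)

(* The order is a field of the mixin rather than an [Order.Lattice] structure:
   Hierarchy Builder admits no common extension of normed modules and lattices
   besides the existing numeric structures. Infima need not be assumed, as
   [- bl_join (- x) (- y)] is the infimum of [x] and [y]. The last axiom says
   that |x| <= |y| implies ||x|| <= ||y||, with |x| the supremum of x and -x. *)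
HB.mixin Record isBanachLattice (R : realType) Y
    of CompleteNormedModule R Y := {
  bl_le : rel Y ;
  bl_join : Y -> Y -> Y ;
  bl_le_refl : reflexive bl_le ;
  bl_le_anti : antisymmetric bl_le ;
  bl_le_trans : transitive bl_le ;
  bl_joinP : forall x y z : Y, bl_le (bl_join x y) z = bl_le x z && bl_le y z ;
  bl_leD2r : forall x y z : Y, bl_le x y -> bl_le (x + z) (y + z) ;
  bl_scale_ge0 : forall (c : R) (x : Y), 0 <= c -> bl_le 0 x -> bl_le 0 (c *: x) ;
  bl_norm_le : forall x y : Y,
    bl_le (bl_join x (- x)) (bl_join y (- y)) -> `|x| <= `|y| }.

#[short(type="banachLatticeType")]
HB.structure Definition BanachLattice (R : realType) :=
  { Y of CompleteNormedModule R Y & isBanachLattice R Y }.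

Notation "x <=L y" := (bl_le x y) : ring_scope.
Notation "x <L y" := ((x <=L y) && (x != y)) : ring_scope.

Section banach_lattice.
Context (R : realType) (Y : banachLatticeType R).

Definition labs (x : Y) : Y := bl_join x (- x).

Definition pos_cone : set Y := [set y | 0 <=L y].

Definition principal_ideal (y : Y) : set Y :=
  [set z | exists m : nat, labs z <=L labs y *+ m].

(* The principal ideal of [y] in the Banach lattice of functions [T -> Y]. *)
Definition principal_ideal_fun (T : Type) (y : T -> Y) : set (T -> Y) :=
  [set z | exists m : nat, forall w, labs (z w) <=L labs (y w) *+ m].

Definition pos_dual (p : {linear Y -> R^o}) : Prop :=
  continuous p /\ forall y, 0 <=L y -> 0 <= p y.

End banach_lattice.

(** * The Bochner integral *)

Section bochner.
Context d (T : measurableType d) (R : realType) (Y : completeNormedModType R).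
Variable mu : {measure set T -> \bar R}.
Implicit Types (D : set T) (f : T -> Y).

Definition simple_integrable D (s : {fimfun T >-> Y}) : Prop :=
  forall y, measurable (D `&` s @^-1` [set y]) /\
    (y != 0 -> (mu (D `&` s @^-1` [set y]) < +oo)%E).

Definition simple_integral D (s : {fimfun T >-> Y}) : Y :=
  \sum_(y \in [set: Y]) fine (mu (D `&` s @^-1` [set y])) *: y.

Definition bochner_approx D f (s : nat -> {fimfun T >-> Y}) : Prop :=
  [/\ forall k, simple_integrable D (s k),
      {ae mu, forall t, D t -> s k t @[k --> \oo] --> f t} &
      (\int[mu]_(t in D) (`|f t - s k t|)%:E)%E @[k --> \oo] --> 0%E].

Definition bochner_integrable D f : Prop := exists s, bochner_approx D f s.

(* The value does not depend on the approximating sequence; it is 0 when [f]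
   is not integrable. *)
Definition bochner_integral D f : Y :=
  xget 0 [set v | exists2 s, bochner_approx D f s &
                   simple_integral D (s k) @[k --> \oo] --> v].

End bochner.

(** * The product norm topology *)

(* For finite [Omega], the product topology of [{ptws Omega -> Y}] is that of
   the norm [max_w `|z w|] (and of all equivalent product norms). *)
Lemma nbhs_ptwsE (R : realType) (Y : normedModType R) (Omega : finType)
    (x : {ptws Omega -> Y}) (A : set {ptws Omega -> Y}) :
  nbhs x A <->
  exists2 e : R, 0 < e & forall z, (forall w, `|x w - z w| < e) -> A z.
Proof.
split; last first.
  move=> [e e0 eA]; apply: (@filterS _ (nbhs x) _
    [set z | forall w, `|x w - z w| < e]).
    by move=> z; exact: eA.
  apply: (@filter_forall _ _
    (fun w => [set z : {ptws Omega -> Y} | `|x w - z w| < e])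
    (nbhs x) (nbhs_filter x)) => w.
  have /(_ _ (nbhsx_ballx (x w) e e0)) := @proj_continuous Omega (fun=> Y) w x.
  by rewrite /= -ball_normE.
pose F : set_system {ptws Omega -> Y} := [set A | exists2 e : R, 0 < e &
   forall z, (forall w, `|x w - z w| < e) -> A z].
have FF : Filter F.
  split.
  - by exists 1.
  - move=> P Q [e e0 eP] [d d0 dQ]; exists (Num.min e d); first by rewrite lt_min e0.
    by move=> z hz; split; [apply: eP|apply: dQ] => w; move: (hz w);
      rewrite lt_min => /andP[].
  - by move=> P Q PQ [e e0 eP]; exists e => // z /eP/PQ.
suff : F --> x by exact.
apply/cvg_sup => w; apply/cvg_image.
  by apply/seteqP; split=> // y _; exists (fun=> y).
move=> B /nbhs_ballP[e /= e0 eB].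
exists [set z | B (z w)] => /=.
  by exists e => // z /(_ w) h; apply: eB; rewrite -ball_normE.
by apply/seteqP; split=> [y [z Bz <-]//|y By]; exists (fun=> y).
Qed.

(** * The discrete economy *)

Definition info_measurable (Omega : finType) (U : Type)
    (P : {set {set Omega}}) (u : Omega -> U) : Prop :=
  forall A w w', A \in P -> w \in A -> w' \in A -> u w = u w'.

Record economy (R : realType) (Y : banachLatticeType R) (Omega : finType)
    (n : nat) := Economy {
  info : 'I_n -> {set {set Omega}} ;
  (* only the restriction to the positive cone is meaningful *)
  utility : 'I_n -> Omega -> Y -> R ;
  endow : 'I_n -> Omega -> Y ;
  prior : 'I_n -> Omega -> R ;
  info_partition : forall i, finset.partition (info i) [set: Omega]%SET ;
  endow_ge0 : forall i w, 0 <=L endow i w ;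
  endow_info : forall i, info_measurable (info i) (endow i) ;
  prior_gt0 : forall i w, 0 < prior i w ;
  prior_sum1 : forall i, \sum_w prior i w = 1 }.

Section discrete.
Context (R : realType) (Y : banachLatticeType R) (Omega : finType) (n : nat).
Variable E : economy Y Omega n.
Implicit Types (i : 'I_n) (u : Omega -> Y) (x y : 'I_n -> Omega -> Y).

Definition exp_utility i u : R := \sum_w utility E i w (u w) * prior E i w.

Definition consumption i : set (Omega -> Y) :=
  [set u | (forall w, 0 <=L u w) /\ info_measurable (info E i) u].

Definition aggregate_endow (w : Omega) : Y := \sum_i endow E i w.

Definition feasible_allocation x : Prop :=
  (forall i, consumption i (x i)) /\
  (forall w, \sum_i x i w <=L aggregate_endow w).

Definition privately_pareto_optimal x : Prop :=
  feasible_allocation x /\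
  ~ exists y, feasible_allocation y /\
      forall i, exp_utility i (x i) < exp_utility i (y i).

Definition preferred i u : set (Omega -> Y) :=
  [set v | consumption i v /\ exp_utility i u < exp_utility i v].

(* The interior is taken in the product norm topology, see [nbhs_ptwsE]. *)
Definition strongly_ATY_proper i u : Prop :=
  exists P : set {ptws Omega -> Y},
    [/\ convex_set (P : set (convex_lmodType (Omega -> Y))),
        P° !=set0,
        P `&` consumption i = preferred i u &
        P° `&` consumption i `&` principal_ideal_fun aggregate_endow !=set0].

(* Every function on [Omega] is measurable for the algebra of all events. *)
Definition price_system (pi : Omega -> {linear Y -> R^o}) : Prop :=
  (forall w, pos_dual (pi w)) /\ exists w (y0 : Y), pi w y0 != 0.

Definition price_value (pi : Omega -> {linear Y -> R^o}) u : R :=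
  \sum_w pi w (u w).

Definition budget (pi : Omega -> {linear Y -> R^o}) i : set (Omega -> Y) :=
  [set u | consumption i u /\ price_value pi u <= price_value pi (endow E i)].

End discrete.

(** * The associated continuum economy *)

Section continuum.
Context (R : realType) (Y : banachLatticeType R) (Omega : finType) (n : nat).
Variable E : economy Y Omega n.
Local Notation mu := (@lebesgue_measure R).
Implicit Types (t : R) (u : Omega -> Y) (f g : R -> Omega -> Y) (S : set R).

Definition agent_space : set R := `[0, 1]%classic.

(* The types being numbered from 0, type [i] occupies [i/n, (i+1)/n[, except
   that the last interval is closed. *)
Definition agents_of (i : 'I_n) : set R :=
  if (i.+1 < n)%N then `[i%:R / n%:R, i.+1%:R / n%:R[%classic
  else `[i%:R / n%:R, 1]%classic.

(* Each agent of [agent_space] has exactly one type, so that the sums and the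
   intersections below select the characteristics of that type. *)
Definition cont_endow t (w : Omega) : Y :=
  \sum_(i < n | t \in agents_of i) endow E i w.

Definition cont_utility t u : R :=
  \sum_(i < n | t \in agents_of i) exp_utility E i u.

Definition cont_consumption t : set (Omega -> Y) :=
  \bigcap_(i in [set i | agents_of i t]) consumption E i.

Definition cont_budget (pi : Omega -> {linear Y -> R^o}) t : set (Omega -> Y) :=
  \bigcap_(i in [set i | agents_of i t]) budget E pi i.

Definition cont_assignment f : Prop :=
  (forall t w, agent_space t -> 0 <=L f t w) /\
  (forall w, bochner_integrable mu agent_space (f ^~ w)).

Definition cont_allocation f : Prop :=
  cont_assignment f /\
  {ae mu, forall t, agent_space t -> cont_consumption t (f t)}.

Definition cont_feasible f : Prop :=
  cont_allocation f /\
  forall w, bochner_integral mu agent_space (f ^~ w) <=L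
            bochner_integral mu agent_space (cont_endow ^~ w).

Definition coalition S : Prop :=
  [/\ measurable S, S `<=` agent_space & (0 < mu S)%E].

Definition privately_blocks S f : Prop :=
  coalition S /\
  exists g,
    [/\ forall t, S t -> cont_consumption t (g t) /\
                         cont_utility t (f t) < cont_utility t (g t),
        forall w, bochner_integrable mu S (g ^~ w) &
        forall w, bochner_integral mu S (g ^~ w) <=L
                  bochner_integral mu S (cont_endow ^~ w)].

Definition private_core : set (R -> Omega -> Y) :=
  [set f | cont_feasible f /\ forall S, ~ privately_blocks S f].

Definition quasi_equilibrium f (pi : Omega -> {linear Y -> R^o}) : Prop :=
  [/\ cont_feasible f, price_system pi,
      forall t, agent_space t ->
        cont_budget pi t (f t) /\
        (price_value pi (cont_endow t) != 0 ->
         forall u, cont_budget pi t u -> cont_utility t u <= cont_utility t (f t)) &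
      price_value pi (fun w => bochner_integral mu agent_space (f ^~ w)) =
      price_value pi (fun w => bochner_integral mu agent_space (cont_endow ^~ w))].

Definition nontrivial_quasi_equilibrium f (pi : Omega -> {linear Y -> R^o}) : Prop :=
  quasi_equilibrium f pi /\
  exists2 S, coalition S &
    forall t, S t -> price_value pi (cont_endow t) != 0.

End continuum.

(* Main.v *)
Require Import Defs.
From HB Require Import structures.
From mathcomp Require Import all_boot all_order all_algebra.
From mathcomp Require Import all_classical all_reals all_analysis.
From mathcomp Require Import measurable_realfun ring lra.
Import Order.TTheory GRing.Theory Num.Theory.
Import numFieldNormedType.Exports.
Local Open Scope classical_set_scope.
Local Open Scope ring_scope.

Set Implicit Arguments.
Unset Strict Implicit.
Unset Printing Implicit Defensive.

(** The idea is the one of the second welfare theorem, with two complications: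
    the positive cone of Y may have empty interior, and agents may only trade
    in bundles measurable for their information.

    Decentralization on an ideal. A coalition made of an initial interval of
    every type, of length proportional to l i, can carry out any redistribution
    in which type i receives y i. Hence a core allocation admits no weights
    l i > 0 and bundles y i preferred to x i with sum l i (y i - a i) <= 0
    ([core_unblocked]); this also gives Pareto optimality. By stability the
    aggregate endowments of all states generate the same ideal J, that of h, so
    that in J^Omega the constant function h is an order unit, measurable for
    every agent. The cone of all u above some sum l i (y i - a i) therefore has
    an internal point relative to J^Omega, and separating it from 0
    ([cone_separation], [supporting_functional]) yields a positive functional p
    on J^Omega with p (x i) = p (a i) and p >= p (a i) on the bundles of
    J^Omega preferred to x i. Nothing makes p norm-continuous yet.

    Continuity from properness. Strong properness extends the set preferred by
    i to a convex set Q with norm-interior. Separating, in Y^Omega x R, the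
    points strictly below the level p (x i) over Q from the epigraph of p over
    the admissible bundles of J^Omega gives a norm-continuous q i with q i <= p
    on those bundles and q i >= p (x i) on Q ([proper_support]). Both functionals
    agree at x i, so on each information block they agree on the ideal generated
    by the common value of x i there. As p also vanishes at the part
    of the aggregate endowment that is not consumed, Riesz decomposition shows
    that every state price p_w is norm-bounded on all of J.

    Extension to Y. The positive functional p_w on J extends to a positive
    continuous functional on Y by the Riesz-Kantorovich formula. To dominate
    q i on measurable bundles outside J^Omega as well, one adds, for each type and
    information block, the positive part of the excess of q i over the sum of
    these extensions; that excess is nonpositive on the positive cone of J, so
    its positive part vanishes on J and no value computed in J^Omega changes
    ([price_extension]). A bundle strictly preferred by i then costs at least
    p (a i), and scaling it down slightly shows that it costs more than a i when
    the endowment has nonzero value. *)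

(** * Algebraic separation of convex cones *)

Section separation.
Context (R : realType) (V : lmodType R).
Implicit Types (C D M : set V) (u v c : V).

Definition convex_cone C : Prop :=
  (forall u v, C u -> C v -> C (u + v)) /\
  (forall t u, 0 < t -> C u -> C (t *: u)).

(** A maximal convex cone that avoids - c0 is a half-space: if neither v nor - v
    belonged to it, both rays could be used to produce - c0. *)
Lemma maximal_convex_cone C c0 : convex_cone C -> C c0 -> ~ C 0 ->
  exists D, [/\ convex_cone D, C `<=` D, D 0, ~ D (- c0) &
    forall v, D v \/ D (- v)].
Proof.
move=> [CD CZ] Cc0 C0.
pose P (D : set V) := [/\ convex_cone D, ~ D (- c0) & D = set0 \/ C `|` [set 0] `<=` D].
have [D [[[DD DZ] Dc0 D0C] Dmax]] : exists D, P D /\ forall B, D `<` B -> ~ P B.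
  apply: Zorn_bigcup => F FP Ftot; split.
  - split=> [u v [X FX Xu] [X' FX' X'v]|t u t0 [X FX Xu]].
      have [XX'|X'X] := Ftot _ _ FX FX'.
        by exists X' => //; have [[h _] _ _] := FP _ FX'; apply: h => //; apply: XX'.
      by exists X => //; have [[h _] _ _] := FP _ FX; apply: h => //; apply: X'X.
    by exists X => //; have [[_ h] _ _] := FP _ FX; apply: h.
  - by move=> [X FX Xc0]; have [_ + _] := FP _ FX.
  - have [[X [FX Xn0]]|nF] := pselect (exists X, F X /\ X !=set0).
      right; have [_ _ [X0|CX]] := FP _ FX; first by move: Xn0; rewrite X0 => -[].
      by move=> z /CX Xz; exists X.
    left; apply/seteqP; split=> // z [X FX Xz]; apply: nF.
    by exists X; split=> //; exists z.
have cone0 : P (C `|` [set 0]).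
  split; last by right.
    split=> [u v [Cu|->] [Cv|->]|t u t0 [Cu|->]].
    - by left; apply: CD.
    - by rewrite addr0; left.
    - by rewrite add0r; left.
    - by rewrite addr0; right.
    - by left; apply: CZ.
    - by rewrite scaler0; right.
  move=> [Cc|/eqP].
    by apply: C0; rewrite -(subrr c0); apply: CD.
  by rewrite oppr_eq0 => /eqP c00; apply: C0; rewrite -c00.
have CD0 : C `|` [set 0] `<=` D.
  case: D0C => // D0; exfalso; apply: Dmax cone0; rewrite D0.
  by split=> // /(_ 0); apply; right.
have D0 : D 0 by apply: CD0; right.
exists D; split=> //.
  by move=> c Cc; apply: CD0; left.
(* Adjoining to D a ray through a point outside D must create -c0. *)
have ray v : ~ D v -> exists d s, [/\ D d, 0 < s & - c0 = d + s *: v].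
  move=> nDv.
  pose B : set V := [set z | exists d s, [/\ D d, 0 <= s & z = d + s *: v]].
  have Bv : B v by exists 0, 1; rewrite ler01 scale1r add0r.
  have DB : D `<=` B by move=> z Dz; exists z, 0; rewrite scale0r addr0.
  have [Bc0|nBc0] := pselect (B (- c0)).
    case: Bc0 => d [s [Dd s0 cE]]; exists d, s; split=> //.
    rewrite lt_neqAle s0 andbT; apply/eqP => s00; apply: Dc0.
    by rewrite cE -s00 scale0r addr0.
  exfalso; apply: (Dmax B); first by split=> // /(_ v Bv).
  split=> //; last by right => z /CD0 /DB.
  split=> [_ _ [d [s [Dd s0 ->]]] [d' [s' [Dd' s0' ->]]]|t _ t0 [d [s [Dd s0 ->]]]].
    exists (d + d'), (s + s'); split; [exact: DD|exact: addr_ge0|].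
    by rewrite scalerDl addrACA.
  exists (t *: d), (t * s); split; [exact: DZ|by rewrite mulr_ge0// ltW|].
  by rewrite scalerDr scalerA.
move=> v; apply: contrapT => /not_orP[/ray[d [s [Dd s0 dE]]] /ray[d' [s' [Dd' s0' dE']]]].
apply: Dc0.
have -> : - c0 = (s + s')^-1 *: (s' *: d + s *: d').
  apply: (@scalerI _ _ (s + s')); first by rewrite gt_eqF ?addr_gt0.
  rewrite scalerA divff ?gt_eqF ?addr_gt0// scale1r addrC scalerDl {1}dE dE'.
  by rewrite !scalerDr !scalerA addrACA scalerN mulrC subrr addr0.
apply: (DZ); first by rewrite invr_gt0 addr_gt0.
by apply: DD; apply: DZ.
Qed.

(** The separating functional is phi v = sup {t | D (v - t c0)} for a maximal
    convex cone D containing C. Internality of c0 is only required in the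
    directions of M, and only there is the supremum finite; superadditivity is
    immediate, and totality of D makes phi odd, hence linear. *)
Lemma cone_separation C M c0 :
    convex_cone C -> ~ C 0 -> C c0 -> M c0 ->
    (forall u v, M u -> M v -> M (u + v)) ->
    (forall a u, M u -> M (a *: u)) ->
    (forall v, M v -> exists t, C (v + t *: c0)) ->
  exists phi : V -> R,
    [/\ forall u v, M u -> M v -> phi (u + v) = phi u + phi v,
        forall a u, M u -> phi (a *: u) = a * phi u,
        forall c, C c -> M c -> 0 <= phi c &
        phi c0 = 1].
Proof.
move=> coneC C0 Cc0 Mc0 MD MZ Mint.
have [D [[DD DZ] CD D0 Dc0 Dtot]] := maximal_convex_cone coneC Cc0 C0.
have Dc0p t : D (t *: c0) -> 0 <= t.
  move=> Dt; rewrite leNgt; apply/negP => t0; apply: Dc0.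
  have -> : - c0 = (- t)^-1 *: (t *: c0).
    by rewrite scalerA invrN mulNr mulVf ?lt_eqF// scaleN1r.
  by apply: DZ => //; rewrite invr_gt0 oppr_gt0.
have Dc0n t : 0 <= t -> D (t *: c0).
  rewrite le_eqVlt => /orP[/eqP<-|t0]; first by rewrite scale0r.
  by apply: DZ => //; apply: CD.
pose S v : set R := [set t | D (v - t *: c0)].
pose phi v := sup (S v).
have MN v : M v -> M (- v) by rewrite -scaleN1r; apply: MZ.
have S0 v : M v -> S v !=set0.
  by move=> /Mint[t Ct]; exists (- t); rewrite /S /= scaleNr opprK; apply: CD.
have Sub v : M v -> has_ubound (S v).
  move=> /MN/Mint[t Ct]; exists t => s Ss; rewrite -subr_ge0; apply: Dc0p.
  have := DD _ _ (CD _ Ct) Ss.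
  by rewrite addrACA addNr add0r -scalerBl.
have phi_ge v t : M v -> D (v - t *: c0) -> t <= phi v.
  by move=> Mv Dv; apply: ub_le_sup => //; apply: Sub.
have phi_le v r : M v -> (forall t, D (v - t *: c0) -> t <= r) -> phi v <= r.
  by move=> Mv h; apply: ge_sup; [apply: S0|move=> t; apply: h].
have M0 : M 0 by rewrite -(scale0r c0); apply: MZ.
have phi00 : phi 0 <= 0.
  by apply: phi_le => // t; rewrite sub0r -scaleNr => /Dc0p; rewrite oppr_ge0.
have superadd u v : M u -> M v -> phi u + phi v <= phi (u + v).
  move=> Mu Mv; rewrite -lerBrDr; apply: (phi_le) => // s Ds.
  rewrite lerBrDl -lerBrDr; apply: (phi_le) => // t Dt.
  rewrite lerBrDl; apply: phi_ge; first exact: MD.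
  by rewrite scalerDl opprD addrACA; apply: DD.
have phiN v : M v -> phi (- v) = - phi v.
  move=> Mv; apply/eqP; rewrite eq_le; apply/andP; split.
    rewrite -subr_le0 opprK; apply: le_trans phi00.
    by rewrite -(addNr v); apply: superadd => //; apply: MN.
  rewrite lerNl leNgt; apply/negP => lt.
  pose r := (phi v - phi (- v)) / 2.
  have [Dv|] := Dtot (v - r *: c0).
    have := phi_ge _ _ Mv Dv; rewrite /r => h.
    by move: lt h; lra.
  rewrite opprB addrC => Dv.
  have : - r <= phi (- v).
    by apply: phi_ge; [apply: MN|rewrite scaleNr opprK].
  by rewrite /r; move: lt; lra.
have phiD u v : M u -> M v -> phi (u + v) = phi u + phi v.
  move=> Mu Mv; apply/eqP; rewrite eq_le superadd// andbT.
  have := superadd _ _ (MN _ Mu) (MN _ Mv).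
  by rewrite -opprD !phiN//; [lra|apply: MD].
have phiZp a v : 0 < a -> M v -> phi (a *: v) = a * phi v.
  have half b u : 0 < b -> M u -> b * phi u <= phi (b *: u).
    move=> b0 Mu; rewrite -ler_pdivlMl//; apply: phi_le => // t Dt.
    rewrite ler_pdivlMl//; apply: phi_ge; first exact: MZ.
    by rewrite -scalerA -scalerBr; apply: DZ.
  move=> a0 Mv; apply/eqP; rewrite eq_le half// andbT.
  rewrite -ler_pdivrMl//; apply: le_trans (half _ _ _ _) _ => //.
  - by rewrite invr_gt0.
  - exact: MZ.
  - by rewrite scalerA mulVf ?gt_eqF// scale1r.
exists phi; split=> //.
- move=> a v Mv; have [a0|a0|->] := ltgtP a 0.
  + rewrite -[a]opprK scaleNr phiN; last exact: MZ.
    by rewrite phiZp ?oppr_gt0// !mulNr.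
  + exact: phiZp.
  + by rewrite scale0r mul0r -(subrr v) phiD ?phiN ?subrr//; apply: MN.
- by move=> c Cc Mc; apply: phi_ge => //; rewrite scale0r subr0; apply: CD.
- apply/eqP; rewrite eq_le; apply/andP; split.
    apply: (phi_le) => // t; rewrite -{1}(scale1r c0) -scalerBl => /Dc0p.
    by rewrite subr_ge0.
  by apply: (phi_ge) => //; rewrite scale1r subrr.
Qed.

End separation.

(** * Banach lattices and the Riesz-Kantorovich formula *)

Section lattice.
Context (R : realType) (Y : banachLatticeType R).
Implicit Types x y z w : Y.

Lemma bl_trans x y z : x <=L y -> y <=L z -> x <=L z.
Proof. exact: bl_le_trans. Qed.

Lemma bl_leD2rE x y z : (x + z <=L y + z) = (x <=L y).
Proof.
apply/idP/idP => [/bl_leD2r - /(_ (- z))|]; last exact: bl_leD2r.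
by rewrite !addrK.
Qed.

Lemma bl_subr_ge0 x y : (0 <=L y - x) = (x <=L y).
Proof. by rewrite -(bl_leD2rE 0 _ x) add0r subrK. Qed.

Lemma bl_leD x y z w : x <=L y -> z <=L w -> x + z <=L y + w.
Proof.
move=> xy zw; apply: (@bl_trans _ (y + z)); first by rewrite bl_leD2rE.
by rewrite ![y + _]addrC bl_leD2rE.
Qed.

Lemma bl_addr_ge0 x y : 0 <=L x -> 0 <=L y -> 0 <=L x + y.
Proof. by move=> x0 y0; rewrite -(addr0 0); apply: bl_leD. Qed.

Lemma bl_leN2 x y : (- x <=L - y) = (y <=L x).
Proof. by rewrite -bl_subr_ge0 opprK addrC bl_subr_ge0. Qed.

Lemma bl_oppr_ge0 x : (0 <=L - x) = (x <=L 0).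
Proof. by rewrite -{1}oppr0 bl_leN2. Qed.

Lemma bl_oppr_le0 x : (- x <=L 0) = (0 <=L x).
Proof. by rewrite -{1}oppr0 bl_leN2. Qed.

Lemma bl_leZ (c : R) x y : 0 <= c -> x <=L y -> c *: x <=L c *: y.
Proof.
move=> c0; rewrite -(bl_subr_ge0 x) -(bl_subr_ge0 (c *: x)) -scalerBr.
exact: bl_scale_ge0.
Qed.

Lemma bl_leZl (a b : R) x : a <= b -> 0 <=L x -> a *: x <=L b *: x.
Proof.
move=> ab x0; rewrite -bl_subr_ge0 -scalerBl; apply: bl_scale_ge0 => //.
by rewrite subr_ge0.
Qed.

Lemma bl_sum_ge0 (I : Type) (s : seq I) (P : pred I) (F : I -> Y) :
  (forall i, P i -> 0 <=L F i) -> 0 <=L \sum_(i <- s | P i) F i.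
Proof.
by move=> F0; elim/big_ind: _ => [|u v|//]; [exact: bl_le_refl|exact: bl_addr_ge0].
Qed.

Lemma bl_le_sum (I : finType) (F : I -> Y) (i : I) :
  (forall j, 0 <=L F j) -> F i <=L \sum_j F j.
Proof.
move=> F0; rewrite (bigD1 i)//= -{1}[F i]addr0.
by apply: bl_leD; [exact: bl_le_refl|apply: bl_sum_ge0].
Qed.

Lemma bl_join_l x y : x <=L bl_join x y.
Proof. by have := bl_joinP x y (bl_join x y); rewrite bl_le_refl => /esym/andP[]. Qed.

Lemma bl_join_r x y : y <=L bl_join x y.
Proof. by have := bl_joinP x y (bl_join x y); rewrite bl_le_refl => /esym/andP[]. Qed.

Lemma labs_ge x : x <=L labs x. Proof. exact: bl_join_l. Qed.

Lemma labs_geN x : - x <=L labs x. Proof. exact: bl_join_r. Qed.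

Lemma labs_le x y : (labs x <=L y) = (x <=L y) && (- x <=L y).
Proof. exact: bl_joinP. Qed.

Lemma labs_ge0 x : 0 <=L labs x.
Proof.
have := bl_leD (labs_ge x) (labs_geN x); rewrite subrr.
rewrite -[labs x + _]/(labs x *+ 2) -scaler_nat => /(bl_leZ (_ : 0 <= 2^-1)).
by rewrite scaler0 scalerA mulVf// scale1r; apply; rewrite invr_ge0.
Qed.

Lemma ger0_labs x : 0 <=L x -> labs x = x.
Proof.
move=> x0; apply: bl_le_anti; rewrite labs_ge andbT labs_le bl_le_refl/=.
by apply: (@bl_trans _ 0) => //; rewrite -(oppr0 Y) bl_leN2.
Qed.

Lemma bl_norm_mono x y : 0 <=L x -> x <=L y -> `|x| <= `|y|.
Proof.
move=> x0 xy; have y0 := bl_trans x0 xy.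
by apply: bl_norm_le; rewrite -!/(labs _) !ger0_labs.
Qed.

Definition ppart x := bl_join x 0.

Lemma ppart_ge0 x : 0 <=L ppart x. Proof. exact: bl_join_r. Qed.

Lemma bl_joinC x y : bl_join x y = bl_join y x.
Proof. by apply: bl_le_anti; rewrite !bl_joinP !bl_join_l !bl_join_r. Qed.

Lemma bl_joinDr x y z : bl_join (x + z) (y + z) = bl_join x y + z.
Proof.
apply: bl_le_anti; rewrite bl_joinP !bl_leD2rE bl_join_l bl_join_r /=.
rewrite -(bl_leD2rE _ _ (- z)) addrK bl_joinP -(bl_leD2rE x _ z) subrK bl_join_l /=.
by rewrite -(bl_leD2rE y _ z) subrK bl_join_r.
Qed.

Lemma ppartB x : x = ppart x - ppart (- x).
Proof.
apply/eqP; rewrite eq_sym subr_eq /ppart addrC -bl_joinDr addNr add0r.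
by rewrite bl_joinC.
Qed.

Lemma ppart_le_labs x : ppart x <=L labs x.
Proof. by rewrite bl_joinP labs_ge labs_ge0. Qed.

Lemma norm_ppart x : `|ppart x| <= `|x|.
Proof.
apply: bl_norm_le; rewrite -!/(labs _) (ger0_labs (ppart_ge0 x)).
exact: ppart_le_labs.
Qed.

Lemma riesz_decomposition w x y :
  0 <=L w -> 0 <=L x -> 0 <=L y -> w <=L x + y ->
  exists u v, [/\ w = u + v, 0 <=L u, u <=L x, 0 <=L v & v <=L y].
Proof.
move=> w0 x0 y0 wxy.
(* u is the infimum of w and x *)
exists (- bl_join (- w) (- x)), (w + bl_join (- w) (- x)); split.
- by rewrite addrCA addNr addr0.
- by rewrite bl_oppr_ge0 bl_joinP !bl_oppr_le0 w0 x0.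
- by rewrite -bl_leN2 opprK bl_join_r.
- by have := bl_join_l (- w) (- x); rewrite -bl_subr_ge0 opprK addrC.
- rewrite addrC -bl_joinDr addNr bl_joinP y0 /= addrC -(bl_leD2rE _ _ x).
  by rewrite subrK addrC.
Qed.

End lattice.

Section linear_of.
Context (R : realType) (Y : lmodType R).

(** A name for f on which the linearity proof can be recorded as a structure. *)
Definition linear_of (f : Y -> R) of linear (f : Y -> R^o) : Y -> R^o := f.

HB.instance Definition _ f f_linear :=
  GRing.isLinear.Build R Y R^o *:%R (@linear_of f f_linear) f_linear.

End linear_of.

Section riesz_kantorovich.
Context (R : realType) (Y : banachLatticeType R).
Implicit Types x y z w : Y.

(** The extension is x |-> G (x^+) - G (x^-); additivity on the cone makes this
    independent of how x is written as a difference of positive elements. *)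
Lemma linear_extension (G : Y -> R) :
    (forall x y, 0 <=L x -> 0 <=L y -> G (x + y) = G x + G y) ->
    (forall a x, 0 < a -> 0 <=L x -> G (a *: x) = a * G x) ->
  exists p : {linear Y -> R^o}, forall x, 0 <=L x -> p x = G x.
Proof.
move=> GD GZ.
have G0 : G 0 = 0.
  have := GD 0 0 (bl_le_refl 0) (bl_le_refl 0); rewrite addr0 => /eqP.
  by rewrite eq_sym -subr_eq0 addrK => /eqP.
pose f x := G (ppart x) - G (ppart (- x)).
have fE x y z : 0 <=L x -> 0 <=L y -> z = x - y -> f z = G x - G y.
  move=> x0 y0 zE; have zx : ppart z + y = x + ppart (- z).
    have {1}-> : ppart z = z + ppart (- z) by rewrite {2}(ppartB z) subrK.
    by have -> : x = z + y; [rewrite zE subrK|rewrite addrAC].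
  have := congr1 G zx; rewrite !GD ?ppart_ge0// /f => GE.
  by apply/eqP; rewrite subr_eq addrAC -GE addrK.
have fD x y : f (x + y) = f x + f y.
  rewrite (fE (ppart x + ppart y) (ppart (- x) + ppart (- y))).
  - by rewrite !GD ?ppart_ge0//= opprD addrACA.
  - by apply: bl_addr_ge0; apply: ppart_ge0.
  - by apply: bl_addr_ge0; apply: ppart_ge0.
  - by rewrite {1}(ppartB x) {1}(ppartB y) opprD addrACA.
have fN x : f (- x) = - f x by rewrite /f opprK opprB.
have fZp a x : 0 < a -> f (a *: x) = a * f x.
  move=> a0; rewrite (fE (a *: ppart x) (a *: ppart (- x))).
  - by rewrite !GZ ?ppart_ge0// mulrBr.
  - by apply: bl_scale_ge0; [exact: ltW|exact: ppart_ge0].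
  - by apply: bl_scale_ge0; [exact: ltW|exact: ppart_ge0].
  - by rewrite -scalerBr -ppartB.
have fZ a x : f (a *: x) = a * f x.
  have [a0|a0|->] := ltgtP a 0; last 2 first.
  - exact: fZp.
  - by rewrite scale0r mul0r /f oppr0 subrr.
  by rewrite -[a in LHS]opprK scaleNr fN fZp ?oppr_gt0// mulNr opprK.
have fL : linear (f : Y -> R^o) by move=> a x y; rewrite fD fZ.
exists (linear_of fL) => x x0; rewrite /= /linear_of (fE x 0) ?bl_le_refl ?subr0//.
by rewrite G0 subr0.
Qed.

Lemma linear_bounded_pos (p : {linear Y -> R^o}) (C : R) :
  (forall x, 0 <=L x -> `|p x| <= C * `|x|) -> 0 <= C -> continuous p.
Proof.
move=> pC C0; apply: bounded_linear_continuous; apply/linear_boundedP.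
exists (C + C); split; first exact: num_real.
move=> r /ltW Cr x; rewrite {1}(ppartB x) linearB.
apply: le_trans (ler_normB _ _) _.
apply: (@le_trans _ _ (C * `|x| + C * `|x|)).
  apply: lerD; apply: le_trans (pC _ (ppart_ge0 _)) _; rewrite ler_wpM2l//.
    exact: norm_ppart.
  by rewrite -(normrN x) norm_ppart.
rewrite -mulrDl; apply: ler_wpM2r => //.
Qed.

Definition order_ideal (J : set Y) : Prop :=
  [/\ J 0, forall x y, J x -> J y -> J (x + y),
      forall a x, J x -> J (a *: x) &
      forall x y, 0 <=L x -> x <=L y -> J y -> J x].

(** The functional p x = sup {g w | J w, 0 <= w <= x} is additive on the cone by
    Riesz decomposition. For positive g it is the least positive extension of g;
    for J the whole space it is the positive part of g. *)
Lemma riesz_kantorovich (J : set Y) (g : Y -> R) (C : R) :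
    order_ideal J -> 0 <= C ->
    (forall x y, J x -> J y -> g (x + y) = g x + g y) ->
    (forall a x, J x -> g (a *: x) = a * g x) ->
    (forall x, J x -> 0 <=L x -> g x <= C * `|x|) ->
  exists p : {linear Y -> R^o}, [/\ pos_dual p,
    forall w x, J w -> 0 <=L w -> w <=L x -> g w <= p x &
    forall x c, 0 <=L x ->
      (forall w, J w -> 0 <=L w -> w <=L x -> g w <= c) -> p x <= c].
Proof.
move=> [J0 JD JZ Jh] C0 gD gZ gC.
have g0 : g 0 = 0 by rewrite -(scale0r 0) gZ// mul0r.
pose S x := [set r | exists w, [/\ J w, 0 <=L w, w <=L x & r = g w]].
pose G x := sup (S x).
have S0 x : 0 <=L x -> S x !=set0 by exists (g 0), 0; split; rewrite ?bl_le_refl.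
have Sub x : has_ubound (S x).
  exists (C * `|x|) => _ [w [Jw w0 wx ->]].
  by apply: le_trans (gC _ Jw w0) _; rewrite ler_wpM2l// bl_norm_mono.
have Gge w x : J w -> 0 <=L w -> w <=L x -> g w <= G x.
  by move=> Jw w0 wx; apply: ub_le_sup; [exact: Sub|exists w].
have Gle x c : 0 <=L x ->
    (forall w, J w -> 0 <=L w -> w <=L x -> g w <= c) -> G x <= c.
  move=> x0 h; apply: ge_sup; first exact: S0.
  by move=> _ [w [Jw w0 wx ->]]; apply: h.
have GD x y : 0 <=L x -> 0 <=L y -> G (x + y) = G x + G y.
  move=> x0 y0; apply/eqP; rewrite eq_le; apply/andP; split.
    apply: Gle; first exact: bl_addr_ge0.
    move=> w Jw w0 wxy.
    have [u [v [wE u0 ux v0 vy]]] := riesz_decomposition w0 x0 y0 wxy.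
    have Ju : J u by apply: Jh Jw => //; rewrite wE -bl_subr_ge0 addrAC subrr add0r.
    have Jv : J v by apply: Jh Jw => //; rewrite wE -bl_subr_ge0 addrK.
    by rewrite wE gD//; apply: lerD; apply: Gge.
  rewrite -lerBrDr; apply: (Gle) => // u Ju u0 ux.
  rewrite lerBrDl -lerBrDr; apply: (Gle) => // v Jv v0 vy.
  rewrite lerBrDl -gD//; apply: Gge; [exact: JD|exact: bl_addr_ge0|exact: bl_leD].
have GZ a x : 0 < a -> 0 <=L x -> G (a *: x) = a * G x.
  have half b z : 0 < b -> 0 <=L z -> b * G z <= G (b *: z).
    move=> b0 z0; rewrite -ler_pdivlMl//; apply: (Gle) => // w Jw w0 wz.
    rewrite ler_pdivlMl// -gZ//; apply: Gge; first exact: JZ.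
      by apply: bl_scale_ge0 => //; exact: ltW.
    by apply: bl_leZ => //; exact: ltW.
  move=> a0 x0; apply/eqP; rewrite eq_le half// andbT.
  rewrite -ler_pdivrMl//; apply: le_trans (half _ _ _ _) _.
  - by rewrite invr_gt0.
  - by apply: bl_scale_ge0 => //; exact: ltW.
  - by rewrite scalerA mulVf ?gt_eqF// scale1r.
have G0 x : 0 <=L x -> 0 <= G x.
  by move=> x0; rewrite -g0; apply: Gge => //; exact: bl_le_refl.
have GC x : 0 <=L x -> G x <= C * `|x|.
  move=> x0; apply: (Gle) => // w Jw w0 wx.
  by apply: le_trans (gC _ Jw w0) _; rewrite ler_wpM2l// bl_norm_mono.
have [p pE] := linear_extension GD GZ.
exists p; split.
- split; last by move=> y y0; rewrite pE// G0.
  apply: linear_bounded_pos C0 => x x0.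
  by rewrite pE// ger0_norm ?GC// G0.
- move=> w x Jw w0 wx; rewrite pE ?Gge//; exact: bl_trans wx.
- by move=> x c x0 h; rewrite pE//; apply: Gle.
Qed.

End riesz_kantorovich.

(** * Bochner integrals of step functions *)

Section step_functions.
Context d (T : measurableType d) (R : realType) (Y : completeNormedModType R).
Variable mu : {measure set T -> \bar R}.

Lemma measurable_fun_bigsetU (K : choiceType) (s : seq K) (B : K -> set T)
    (h : T -> \bar R) :
  (forall k, measurable (B k)) -> (forall k, measurable_fun (B k) h) ->
  measurable_fun (\big[setU/set0]_(k <- s) B k) h.
Proof.
move=> mB mh; elim: s => [|k s IH]; first by rewrite big_nil; exact: measurable_fun_set0.
by rewrite big_cons; apply/measurable_funU => //; exact: bigsetU_measurable.
Qed.

Lemma bigsetU_seqE (K : choiceType) (s : seq K) (B : K -> set T) (D : set T) :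
  (forall k, B k `<=` D) -> (forall t, D t -> exists2 k, k \in s & B k t) ->
  D = \big[setU/set0]_(k <- s) B k.
Proof.
move=> BD DB; rewrite -bigcup_seq; apply/seteqP; split=> [t /DB[k ks Bt]|t [k _ /BD]//].
by exists k.
Qed.

Lemma integral_norm_pieces (K : choiceType) (s : seq K) (B : K -> set T) (D : set T)
    (h : T -> R) (c : K -> R) :
    uniq s -> (forall k, measurable (B k)) -> trivIset [set` s] B ->
    (forall k, B k `<=` D) -> (forall t, D t -> exists2 k, k \in s & B k t) ->
    (forall t, 0 <= h t) -> (forall k t, B k t -> h t = c k) ->
  (\int[mu]_(t in D) (h t)%:E = \sum_(k <- s) (c k)%:E * mu (B k))%E.
Proof.
move=> us mB tB BD DB h0 hc; rewrite (bigsetU_seqE BD DB).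
rewrite ge0_integral_bigsetU//; last 2 first.
- apply: measurable_fun_bigsetU => // k.
  apply: (eq_measurable_fun (cst (c k)%:E)); last exact: measurable_cst.
  by move=> t; rewrite inE /= => /hc ->.
- by move=> t _; rewrite lee_fin.
apply: eq_bigr => k _; rewrite -integral_cst//; apply: eq_integral => t.
by rewrite inE => /hc ->.
Qed.

Lemma measure_pieces (K : choiceType) (s : seq K) (B : K -> set T) (D : set T) :
    uniq s -> (forall k, measurable (B k)) -> trivIset [set` s] B ->
    (forall k, B k `<=` D) -> (forall t, D t -> exists2 k, k \in s & B k t) ->
    (mu D < +oo)%E -> measurable D ->
  fine (mu D) = \sum_(k <- s) fine (mu (B k)).
Proof.
move=> us mB tB BD DB fD mD.
have := @integral_norm_pieces K s B D (cst 1) (cst 1) us mB tB BD DB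
  (fun=> ler01) (fun _ _ _ => erefl).
rewrite (_ : integral _ _ _ = mu D); last by rewrite -[RHS]mul1e -integral_cst.
move=> ->.
rewrite (eq_bigr (fun k => (fine (mu (B k)))%:E)) ?sumEFin// => k _.
rewrite mul1e fineK// ge0_fin_numE//; apply: le_lt_trans fD.
by apply: le_measure => //; rewrite inE.
Qed.

Section step.
Variables (D : set T) (I : finType) (A : I -> set T) (y : I -> Y) (g : T -> Y).
Hypothesis mD : measurable D.
Hypothesis fD : (mu D < +oo)%E.
Hypothesis mA : forall i, measurable (A i).
Hypothesis tA : forall i j t, A i t -> A j t -> i = j.
Hypothesis DA : forall t, D t -> exists i, A i t.
Hypothesis gE : forall i t, D t -> A i t -> g t = y i.

Definition step_integral : Y := \sum_i fine (mu (D `&` A i)) *: y i.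

(** Both sides are sums over the common refinement of the partitions given by
    the A i and by the values of s. This is what makes the integral of a step
    function independent of the approximating sequence. *)
Lemma simple_integral_close (s : {fimfun T >-> Y}) : simple_integrable mu D s ->
  (`|step_integral - simple_integral mu D s|%:E <=
   \int[mu]_(t in D) (`|g t - s t|)%:E)%E.
Proof.
move=> si.
have sfin : finite_set (range s) by exact: fimfunP.
pose r : seq Y := finmap.enum_fset (fset_set (range s)).
have rP t : s t \in r by rewrite in_fset_set// inE; exists t.
have ur : uniq r by exact: finmap.fset_uniq.
pose B (k : I * Y) := D `&` A k.1 `&` s @^-1` [set k.2].
have mB k : measurable (B k).
  rewrite /B setIAC; apply: measurableI => //.
  by have [] := si k.2.
pose K := [seq (i, z) | i <- enum I, z <- r].
have uK : uniq K by apply: allpairs_uniq => //; [exact: enum_uniq|move=> [? ?] [? ?]].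
have tB (S : set (I * Y)) : trivIset S B.
  move=> [i z] [j z'] _ _ [t [[[_ /= Ai] sz] [[_ /= Aj] sz']]].
  by congr pair; [exact: (tA Ai Aj)|rewrite -sz -sz'].
have DB t : D t -> exists2 k, k \in K & B k t.
  move=> Dt; have [i Ai] := DA Dt; exists (i, s t); last by split.
  by apply/allpairsP; exists (i, s t); split; [rewrite mem_enum|exact: rP|].
rewrite (@integral_norm_pieces _ K B _ _ (fun k => `|y k.1 - k.2|))//; last 2 first.
- by move=> k t [[]].
- by move=> k t [[Dt /gE ->//] ->].
have fB k : mu (B k) = (fine (mu (B k)))%:E.
  rewrite fineK// ge0_fin_numE//; apply: le_lt_trans fD.
  by apply: le_measure; rewrite ?inE// => t [[]].
under eq_bigr do rewrite fB -EFinM.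
rewrite sumEFin lee_fin.
have -> : step_integral = \sum_(k <- K) fine (mu (B k)) *: y k.1.
  rewrite /step_integral /K big_allpairs big_enum /=; apply: eq_bigr => i _.
  rewrite -scaler_suml; congr (_ *: _).
  apply: measure_pieces => //.
  - by move=> z z' _ _ [t [[_ /= <-] [_ /= <-]]].
  - by move=> z t [].
  - by move=> t DAt; exists (s t).
  - by apply: le_lt_trans fD; apply: le_measure; rewrite ?inE//; apply: measurableI.
  - exact: measurableI.
have -> : simple_integral mu D s = \sum_(k <- K) fine (mu (B k)) *: k.2.
  rewrite /K big_allpairs exchange_big /=.
  rewrite /simple_integral.
  rewrite [LHS](_ : _ = \sum_(z \in range s) fine (mu (D `&` s @^-1` [set z])) *: z).
    rewrite fsbig_finite//=; apply: eq_bigr => z _.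
    rewrite -scaler_suml; congr (_ *: _); apply: measure_pieces.
    - exact: enum_uniq.
    - by move=> i; exact: mB (i, z).
    - by move=> i j _ _ [t [[[_ /= Ai] _] [[_ /= Aj] _]]]; exact: (tA Ai Aj).
    - by move=> i t [[]].
    - by move=> t [Dt st]; have [i Ai] := DA Dt; exists i; rewrite ?mem_enum.
    - by apply: le_lt_trans fD; apply: le_measure; rewrite ?inE//; have [] := si z.
    - by have [] := si z.
  apply/esym/fsbig_widen => // z [_ /= nz].
  rewrite [X in mu X](_ : _ = set0) ?measure0 ?scale0r//.
  by apply/seteqP; split=> // t [_ sz]; apply: nz; exists t.
rewrite -sumrB; under eq_bigr do rewrite -scalerBr.
apply: le_trans (ler_norm_sum _ _ _) _.
apply: ler_sum => k _; rewrite normrZ ger0_norm ?fine_ge0// mulrC; exact: lexx.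
Qed.

Lemma bochner_step : bochner_integrable mu D g /\
  bochner_integral mu D g = step_integral.
Proof.
pose h t := if `[< D t >] then g t else 0.
have hfin : finite_set (range h).
  apply: (@sub_finite_set _ _ (0 |` [set y i | i in [set: I]])).
    move=> _ [t _ <-]; rewrite /h; case: asboolP => [Dt|]; last by left.
    by right; have [i Ai] := DA Dt; exists i => //; rewrite (gE Dt Ai).
  by rewrite finite_setU; split=> //; exact: finite_image.
pose hF := FiniteImage.Build T Y h hfin.
pose s : {fimfun T >-> Y} := HB.pack h hF.
have hE t : D t -> h t = g t by rewrite /h; case: asboolP.
have sE t : D t -> s t = g t by exact: hE.
have si : simple_integrable mu D s.
  move=> z.
  have -> : D `&` s @^-1` [set z] = \bigcup_(i in [set i | y i = z]) (D `&` A i).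
    apply/seteqP; split=> t [].
      move=> Dt; rewrite /= hE// => gz; have [i Ai] := DA Dt.
      by exists i => //=; rewrite -gz (gE Dt Ai).
    move=> i /= iz [Dt Ai]; split=> //=.
    by rewrite hE// (gE Dt Ai).
  have mU : measurable (\bigcup_(i in [set i | y i = z]) (D `&` A i)).
    by apply: fin_bigcup_measurable => // i _; exact: measurableI.
  split=> // _; apply: le_lt_trans fD; apply: le_measure; rewrite ?inE//.
  by move=> t [i _ []].
have int0 : (\int[mu]_(t in D) (`|g t - s t|)%:E = 0)%E.
  by apply: integral0_eq => t Dt; rewrite sE// subrr normr0.
have sapp : bochner_approx mu D g (fun=> s).
  split=> //.
    by apply: aeW => t Dt; rewrite sE//; exact: cvg_cst.
  by rewrite int0; exact: cvg_cst.
have sI : simple_integral mu D s = step_integral.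
  apply/eqP; rewrite eq_sym -subr_eq0 -normr_le0 -lee_fin.
  by apply: le_trans (simple_integral_close si) _; rewrite int0.
have uniq v : (exists2 s, bochner_approx mu D g s &
     simple_integral mu D (s k) @[k --> \oo] --> v) -> v = step_integral.
  move=> [s' [s'i _ s'0] s'v].
  apply/eqP; rewrite -subr_eq0 -normr_le0; apply/ler_addgt0Pr => e e0; rewrite add0r.
  have e2 : 0 < e / 2 by rewrite divr_gt0.
  have /cvgrPdist_lt/(_ _ e2) Hv := s'v.
  have /fine_cvgP[s'fin /cvgrPdist_lt/(_ _ e2) H0] := s'0.
  have [k [kv kfin k0]] : exists k, [/\ `|v - simple_integral mu D (s' k)| < e / 2,
      (\int[mu]_(t in D) (`|g t - s' k t|)%:E)%E \is a fin_num &
      `|0 - fine (\int[mu]_(t in D) (`|g t - s' k t|)%:E)%E| < e / 2].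
    apply: (@filter_ex _ (\oo : set_system nat)).
    by near=> k; split; near: k.
  have := simple_integral_close (s'i k); rewrite -(fineK kfin) lee_fin => close.
  move: k0; rewrite sub0r normrN => /(le_lt_trans (ler_norm _)) k0.
  rewrite (_ : v - _ = (v - simple_integral mu D (s' k)) -
     (step_integral - simple_integral mu D (s' k))); last first.
    by rewrite opprB addrA subrK.
  apply: le_trans (ler_normB _ _) _; rewrite [e in leRHS]splitr.
  by apply: lerD; [exact: ltW|exact: le_trans close (ltW k0)].
split; first by exists (fun=> s).
rewrite /bochner_integral; case: xgetP => [v _ /uniq//|noV].
exfalso; apply: (noV step_integral); exists (fun=> s) => //.
by rewrite sI; exact: cvg_cst.
Unshelve. all: by end_near. Qed.

End step.
End step_functions.

(** * Blocking coalitions of the continuum economy *)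

Section agent_types.
Context (R : realType) (n : nat).
Hypothesis n_gt0 : (0 < n)%N.
Local Notation mu := (@lebesgue_measure R).
Local Notation ag := (@agents_of R n).
Implicit Types (i j : 'I_n) (t : R).

Let n0 : 0 < n%:R :> R. Proof. by rewrite ltr0n. Qed.

Lemma agents_ofE i t : ag i t <->
  [/\ i%:R / n%:R <= t, t <= 1 & ((i.+1 < n)%N -> t < i.+1%:R / n%:R)].
Proof.
rewrite /agents_of; case: ifP => [iltn|_] /=; rewrite in_itv/=; last first.
  by split=> [/andP[]|[-> ->]].
split=> [/andP[-> t1]|[-> _ ->//]]; split=> //.
apply: ltW; apply: lt_le_trans t1 _.
by rewrite ler_pdivrMr// mul1r ler_nat ltnW.
Qed.

Lemma agents_of_inj i j t : ag i t -> ag j t -> i = j.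
Proof.
wlog ij : i j / (i <= j)%N => [h ai aj|/agents_ofE[_ _ ti] /agents_ofE[jt _ _]].
  by have [|/ltnW] := leqP i j => ij; [exact: h|apply/esym/h].
apply/val_inj/eqP; rewrite eqn_leq ij /= leqNgt; apply/negP => iltj.
have := lt_le_trans (ti (leq_ltn_trans iltj (ltn_ord j))) (_ : _ <= j%:R / n%:R).
by rewrite ler_pM2r ?invr_gt0// ler_nat ltNge jt => /(_ iltj).
Qed.

Lemma agents_of_cover t : agent_space t -> exists i, ag i t.
Proof.
rewrite /agent_space /= in_itv /= => /andP[t0 t1].
have P0 : (Ordinal n_gt0)%:R / n%:R <= t by rewrite mul0r.
case: (@arg_maxnP _ (Ordinal n_gt0) (fun i : 'I_n => i%:R / n%:R <= t) (fun i => i) P0).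
move=> i it imax; exists i; apply/agents_ofE; split=> // iltn.
rewrite ltNge; apply/negP => h.
by have := imax (Ordinal iltn) h; rewrite /= ltnn.
Qed.

Lemma agents_of_sub i : ag i `<=` agent_space (R := R).
Proof.
move=> t /agents_ofE[it t1 _]; rewrite /agent_space /= in_itv /= t1 andbT.
by apply: le_trans it; rewrite divr_ge0.
Qed.

Lemma measurable_agents_of i : measurable (ag i).
Proof. by rewrite /agents_of; case: ifP => _; exact: measurable_itv. Qed.

Lemma measure_agents_of i : mu (ag i) = (n%:R^-1)%:E.
Proof.
have nE : n%:R != 0 :> R by rewrite gt_eqF.
have iS : i.+1%:R / n%:R = i%:R / n%:R + n%:R^-1 :> R.
  by rewrite -natr1 mulrDl mul1r.
rewrite /agents_of; case: ifPn => [iltn|nilt]; rewrite lebesgue_measure_itv /= lte_fin.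
  rewrite iS ltrDl invr_gt0 n0 -EFinB; congr EFin.
  by rewrite addrAC subrr add0r.
have niE : n = i.+1 by apply/eqP; rewrite eqn_leq ltn_ord leqNgt nilt.
have E1 : 1 = i%:R / n%:R + n%:R^-1 :> R by rewrite -iS -niE divff.
have lt1 : i%:R / n%:R < 1 :> R by rewrite [X in _ < X]E1 ltrDl invr_gt0.
by rewrite lt1 -EFinB [X in (X - _)%:E]E1 addrAC subrr add0r.
Qed.

(** The first agents of type i, forming a group of size l i when l i < 1 / n. *)
Definition sub_agents (l : 'I_n -> R) i : set R :=
  `[i%:R / n%:R, i%:R / n%:R + l i[%classic.

Lemma sub_agents_of l i : l i < n%:R^-1 -> sub_agents l i `<=` ag i.
Proof.
move=> ln t; rewrite /sub_agents /= in_itv /= => /andP[it tl].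
have tS : t < i.+1%:R / n%:R.
  by apply: lt_le_trans tl _; rewrite -natr1 mulrDl mul1r lerD2l ltW.
apply/agents_ofE; split=> //; apply: ltW; apply: lt_le_trans tS _.
by rewrite ler_pdivrMr// mul1r ler_nat.
Qed.

Lemma measure_sub_agents l i : 0 < l i -> mu (sub_agents l i) = (l i)%:E.
Proof.
move=> l0; rewrite lebesgue_measure_itv /= lte_fin ltrDl l0 -EFinB.
by rewrite addrAC subrr add0r.
Qed.

End agent_types.

Section continuum_facts.
Context (R : realType) (Y : banachLatticeType R) (Omega : finType) (n : nat).
Hypothesis n_gt0 : (0 < n)%N.
Variable E : economy Y Omega n.
Local Notation mu := (@lebesgue_measure R).
Implicit Types (i : 'I_n) (t : R) (x y : 'I_n -> Omega -> Y).

(** Every agent of type i receives y i. *)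
Definition type_fun y t (w : Omega) : Y := \sum_(i < n | t \in agents_of i) y i w.

Lemma big_agents_of (V : nmodType) (F : 'I_n -> V) i t : agents_of i t ->
  \sum_(j < n | t \in agents_of j) F j = F i.
Proof.
move=> it; rewrite (big_pred1 i)// => j; apply/idP/eqP => [|->]; last exact/mem_set.
by move=> /set_mem jt; exact: (agents_of_inj n_gt0 jt it).
Qed.

Lemma type_funE y i t : agents_of i t -> type_fun y t = y i.
Proof. by move=> it; apply/funext => w; exact: big_agents_of. Qed.

Lemma cont_consumptionE i t u : agents_of i t ->
  cont_consumption E t u <-> consumption E i u.
Proof.
move=> it; split=> [/(_ i it)//|ui j /= jt].
by rewrite (agents_of_inj n_gt0 jt it).
Qed.

Lemma cont_budgetE pi i t u : agents_of i t ->
  cont_budget E pi t u <-> budget E pi i u.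
Proof.
move=> it; split=> [/(_ i it)//|ui j /= jt].
by rewrite (agents_of_inj n_gt0 jt it).
Qed.

Lemma cont_utilityE i t u : agents_of i t -> cont_utility E t u = exp_utility E i u.
Proof. exact: big_agents_of. Qed.

Lemma integral_type_fun (D : set R) (y : 'I_n -> Omega -> Y) (g : R -> Omega -> Y) w :
    measurable D -> D `<=` agent_space (R := R) ->
    (forall i t, D t -> agents_of i t -> g t = y i) ->
  bochner_integrable mu D (g ^~ w) /\
  bochner_integral mu D (g ^~ w) = \sum_i fine (mu (D `&` agents_of i)) *: y i w.
Proof.
move=> mD D1 gE; apply: bochner_step => //.
- apply: (@le_lt_trans _ _ (mu (agent_space (R := R)))).
    by apply: le_measure; rewrite ?inE//; exact: measurable_itv.
  by rewrite lebesgue_measure_itv /= lte_fin ltr01 -EFinB ltry.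
- by move=> i; exact: measurable_agents_of.
- by move=> i j t; exact: agents_of_inj.
- by move=> t /D1; exact: (agents_of_cover n_gt0).
- by move=> i t Dt it; rewrite (gE i).
Qed.

Lemma integral_agent_space y g w :
    (forall i t, agents_of i t -> g t = y i) ->
  bochner_integral mu (agent_space (R := R)) (g ^~ w) = n%:R^-1 *: \sum_i y i w.
Proof.
move=> gE; rewrite (integral_type_fun (y := y) w _ _ _).2//; last 2 first.
- exact: measurable_itv.
- by move=> i t _; exact: gE.
rewrite scaler_sumr; apply: eq_bigr => i _; rewrite setIidr ?measure_agents_of//.
exact: agents_of_sub.
Qed.

Context (f : R -> Omega -> Y) (x : 'I_n -> Omega -> Y).
Hypothesis f_type : forall i t, agents_of i t -> f t = x i.

(** An allocation in the continuum is admissible only almost everywhere, but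
    each type has positive measure, so some agent of each type is admissible. *)
Lemma type_allocation_feasible : cont_feasible E f -> feasible_allocation E x.
Proof.
move=> [[_ fC] fle]; split=> [i|w]; last first.
  have := fle w; rewrite !(integral_agent_space _ f_type).
  rewrite (integral_agent_space (y := endow E)); last first.
    by move=> i t it; exact: type_funE.
  have n0 : 0 < n%:R :> R by rewrite ltr0n.
  move=> /(bl_leZ (ltW n0)); rewrite !scalerA divff ?gt_eqF//.
  by rewrite !scale1r.
have [t [it]] : exists t, agents_of i t /\ cont_consumption E t (f t).
  apply: contrapT => no; have : mu (agents_of i) = 0%E.
    apply/eqP; rewrite -measure_le0.
    have [N [mN N0 subN]] := fC.
    rewrite -N0; apply: le_measure; rewrite ?inE//; first exact: measurable_agents_of.
    move=> t it; apply: subN => /= h; apply: no; exists t; split=> //.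
    by apply: h; exact: agents_of_sub it.
  rewrite measure_agents_of// => /eqP; rewrite eqe invr_eq0 pnatr_eq0.
  by rewrite eqn0Ngt n_gt0.
by move=> /(cont_consumptionE _ it); rewrite (f_type it).
Qed.

(** Only ratios of the weights matter, so they can be scaled down until each
    type contains a group of agents of measure l i; the union of these groups
    would block by giving y i to its members of type i. *)
Lemma core_unblocked (l : 'I_n -> R) y :
    private_core E f -> (forall i, 0 < l i) ->
    (forall i, preferred E i (x i) (y i)) ->
  ~ forall w, \sum_i l i *: (y i w - endow E i w) <=L 0.
Proof.
move=> [_ nob] l0 Py yle.
have n0 : 0 < n%:R :> R by rewrite ltr0n.
(* c * l i <= 1 / (2 n) for every i *)
pose c := (2 * n%:R * (1 + \sum_i l i))^-1.
have L0 : 0 <= \sum_i l i by apply: sumr_ge0 => i _; exact: ltW.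
have L1 : 0 < 1 + \sum_i l i by rewrite ltr_wpDr.
have c0 : 0 < c by rewrite invr_gt0 !mulr_gt0.
pose m i := c * l i.
have m0 i : 0 < m i by rewrite mulr_gt0.
have m1 i : m i < n%:R^-1.
  have lL : l i <= \sum_j l j.
    by rewrite (bigD1 i)//= lerDl; apply: sumr_ge0 => j _; exact: ltW.
  rewrite ltr_pdivrMl ?mulr_gt0// mulrAC -[2 * _ / _]mulrA divff ?gt_eqF// mulr1.
  by move: L1 lL L0 (l0 i); lra.
pose S := \bigcup_(i in [set: 'I_n]) sub_agents m i.
have SI i : S `&` agents_of i = sub_agents m i.
  apply/seteqP; split=> [t [[j _ tj] ti]|t ti].
    by rewrite (agents_of_inj n_gt0 ti (sub_agents_of n_gt0 (m1 j) tj)).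
  by split; [exists i|exact: sub_agents_of ti].
have mS : measurable S.
  by apply: fin_bigcup_measurable => // i _; exact: measurable_itv.
have S1 : S `<=` agent_space (R := R).
  by move=> t [i _ /(sub_agents_of n_gt0 (m1 i))]; exact: agents_of_sub.
have coalS : coalition S.
  split=> //; apply: (@lt_le_trans _ _ (mu (sub_agents m (Ordinal n_gt0)))).
    by rewrite measure_sub_agents// lte_fin.
  apply: le_measure; rewrite ?inE//; first exact: measurable_itv.
  by move=> t ti; exists (Ordinal n_gt0).
have intS z w : (forall i t, S t -> agents_of i t -> type_fun z t = z i) ->
    bochner_integral mu S (type_fun z ^~ w) = \sum_i m i *: z i w.
  move=> zE; rewrite (integral_type_fun w mS S1 zE).2.
  by apply: eq_bigr => i _; rewrite SI measure_sub_agents.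
have tE z i t : S t -> agents_of i t -> type_fun z t = z i by move=> _; exact: type_funE.
apply: (nob S); split=> //; exists (type_fun y); split.
- move=> t /S1/(agents_of_cover n_gt0)[i it]; have [yi xy] := Py i.
  by split; [apply/(cont_consumptionE _ it)|rewrite !(cont_utilityE _ it) (f_type it)];
    rewrite (type_funE _ it).
- by move=> w; exact: (integral_type_fun w mS S1 (tE y)).1.
- move=> w; rewrite -[X in _ <=L bochner_integral _ _ X]/(type_fun (endow E) ^~ w).
  rewrite (intS _ _ (tE y)) (intS _ _ (tE (endow E))).
  rewrite -bl_subr_ge0 (_ : _ - _ =
    - (c *: \sum_i l i *: (y i w - endow E i w))); last first.
    rewrite -sumrB scaler_sumr -sumrN; apply: eq_bigr => i _.
    by rewrite scalerA scalerBr opprB.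
  by have := bl_leZ (ltW c0) (yle w); rewrite scaler0 bl_oppr_ge0.
Qed.
End continuum_facts.

(** * A functional supporting an unblocked allocation *)

Section supporting_functional.
Context (R : realType) (Y : banachLatticeType R) (Omega : finType) (I : finType).
Local Notation V := (Omega -> Y).
Variables (K : set V) (h : V) (a x : I -> V) (P : I -> set V).
Implicit Types (u v : V) (i : I).
Hypothesis KD : forall u v, K u -> K v -> K (u + v).
Hypothesis KZ : forall (c : R) u, K u -> K (c *: u).
Hypothesis h_unit : forall u, K u -> exists2 c : R, 0 < c & forall w, u w <=L c *: h w.
Hypothesis Kh : K h.
Hypothesis Ka : forall i, K (a i).
Hypothesis Kx : forall i, K (x i).
Hypothesis x_feasible : forall w, \sum_i x i w <=L \sum_i a i w.
Hypothesis h_le_a : exists2 c : R, 0 < c & forall w, h w <=L c *: \sum_i a i w.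
Hypothesis P_convex : forall i (s t : R) u v, 0 < s -> 0 < t -> s + t = 1 ->
  P i u -> P i v -> P i (s *: u + t *: v).
Hypothesis P_monotone : forall i (c : R), 0 < c -> P i (x i + c *: h).
Hypothesis P_unblocked : forall (l : I -> R) (y : I -> V),
  (forall i, 0 < l i) -> (forall i, P i (y i)) ->
  ~ forall w, \sum_i l i *: (y i w - a i w) <=L 0.

Let C : set V := [set u | exists (l : I -> R) (y : I -> V),
  [/\ forall i, 0 < l i, forall i, P i (y i) &
      forall w, \sum_i l i *: (y i w - a i w) <=L u w]].

Let C_cone : convex_cone C.
Proof.
split=> [u v [l [y [l0 Py yu]]] [m [z [m0 Pz zv]]]|t u t0 [l [y [l0 Py yu]]]].
  pose s i := l i + m i.
  have s0 i : 0 < s i by rewrite addr_gt0.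
  exists s, (fun i => (l i / s i) *: y i + (m i / s i) *: z i); split=> // [i|w].
    apply: P_convex => //; [exact: divr_gt0|exact: divr_gt0|].
    by rewrite -mulrDl -/(s i) divff// gt_eqF.
  apply: bl_trans (bl_leD (yu w) (zv w)).
  rewrite -big_split /=.
  rewrite (eq_bigr (fun i => l i *: (y i w - a i w) + m i *: (z i w - a i w))).
    exact: bl_le_refl.
  move=> i _; rewrite scalerBr.
  rewrite -[X in s i *: X]/((l i / s i) *: y i w + (m i / s i) *: z i w).
  rewrite scalerDr !scalerA mulrC divfK ?gt_eqF//.
  rewrite [s i * _]mulrC divfK ?gt_eqF// /s scalerDl !scalerBr.
  by rewrite addrACA -opprD.
exists (fun i => t * l i), y; split=> // [i|w]; first by rewrite mulr_gt0.
under eq_bigr do rewrite -scalerA.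
by rewrite -scaler_sumr; apply: bl_leZ => //; exact: ltW.
Qed.

(** The cone C of net trades and what lies above them contains
    c0 = u0 + h with u0 a net trade, and for v >= - c h the point v + c c0 lies
    above c u0; so c0 is internal in K. Once p separates, p (a i) <= p (x i)
    follows by letting t tend to 0 in x i + t h, and feasibility turns these
    inequalities into equalities. *)
Lemma supporting_functional : exists p : V -> R,
  [/\ (forall u v, K u -> K v -> p (u + v) = p u + p v) /\
      (forall c u, K u -> p (c *: u) = c * p u),
      forall u, K u -> (forall w, 0 <=L u w) -> 0 <= p u,
      forall i, p (x i) = p (a i),
      forall i u, K u -> P i u -> p (a i) <= p u &
      p (\sum_i x i) = p (\sum_i a i) /\ 0 < p (\sum_i a i)].
Proof.
have KN u : K u -> K (- u) by rewrite -scaleN1r; exact: KZ.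
have K0 : K 0 by rewrite -(scale0r h); exact: KZ.
have Ksum (F : I -> V) (A : pred I) : (forall i, K (F i)) -> K (\sum_(i | A i) F i).
  by move=> KF; elim/big_ind: _.
pose b i := x i + 1 *: h.
pose u0 := \sum_i (b i - a i).
have Kb i : K (b i) by apply: KD => //; exact: KZ.
have Kba i : K (b i - a i) by apply: KD => //; exact: KN.
have Ku0 : K u0 by apply: Ksum.
have Pb i : P i (b i) by apply: P_monotone.
have sumE (F : I -> V) (A : pred I) w : (\sum_(i | A i) F i) w = \sum_(i | A i) F i w.
  by rewrite fct_sumE.
have h0 w : 0 <=L h w.
  have [c c0 hc] := h_unit (KN _ Kh).
  have : 0 <=L (c + 1) *: h w.
    have := hc w; rewrite -[(- h) w]/(- h w) -bl_subr_ge0 opprK.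
    by rewrite scalerDl scale1r.
  have c1 : 0 < c + 1 by rewrite addr_gt0.
  move=> /(bl_leZ (ltW (_ : 0 < (c + 1)^-1))).
  by rewrite invr_gt0 c1 => /(_ isT); rewrite scaler0 scalerA mulVf ?gt_eqF// scale1r.
pose c0 := u0 + h.
have Cu u (t : R) : 0 < t -> (forall w, t *: u0 w <=L u w) -> C u.
  move=> t0 tu; exists (fun=> t), b; split=> // w.
  by rewrite -scaler_sumr; have := tu w; rewrite /u0 sumE.
have Cc0 : C c0.
  apply: (Cu _ 1) => // w; rewrite scale1r -[c0 w]/(u0 w + h w).
  by rewrite -{1}(addr0 (u0 w)); apply: bl_leD; rewrite ?bl_le_refl.
have nC0 : ~ C 0.
  by move=> [l [y [l0 Py yle]]]; exact: (P_unblocked l0 Py yle).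
have Kc0 : K c0 by apply: KD.
have Cint v : K v -> exists t, C (v + t *: c0).
  move=> Kv; have [c cgt0 vc] := h_unit (KN _ Kv); exists c; apply: (Cu _ c) => // w.
  rewrite -[(v + c *: c0) w]/(v w + c *: (u0 w + h w)) scalerDr addrCA.
  rewrite -{1}(addr0 (c *: u0 w)); apply: bl_leD; first exact: bl_le_refl.
  by have := vc w; rewrite -[(- v) w]/(- v w) -bl_subr_ge0 opprK addrC.
have [p [pD pZ pC pc0]] := cone_separation C_cone nC0 Cc0 Kc0 KD KZ Cint.
have p00 : p 0 = 0 by rewrite -(scale0r 0) pZ ?mul0r.
have pN u : K u -> p (- u) = - p u by move=> Ku; rewrite -scaleN1r pZ// mulN1r.
have pB u v : K u -> K v -> p (u - v) = p u - p v.
  by move=> Ku Kv; rewrite pD ?pN//; exact: KN.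
have psum (F : I -> V) (A : pred I) : (forall i, K (F i)) ->
    p (\sum_(i | A i) F i) = \sum_(i | A i) p (F i).
  move=> KF; suff [] : K (\sum_(i | A i) F i) /\
    p (\sum_(i | A i) F i) = \sum_(i | A i) p (F i) by [].
  elim/big_ind2: _ => // u r v s [Ku <-] [Kv <-]; split; [exact: KD|exact: pD].
have ppos u : K u -> (forall w, 0 <=L u w) -> 0 <= p u.
  move=> Ku up; rewrite leNgt; apply/negP => pu.
  pose t := - 2 / p u.
  have t0 : 0 < t by rewrite /t mulNr oppr_gt0 pmulr_rlt0// invr_lt0.
  have : 0 <= p (c0 + t *: u).
    apply: pC; last by apply: KD => //; exact: KZ.
    case: Cc0 => l [y [l0 Py yu]]; exists l, y; split=> // w.
    rewrite -[_ w]/(c0 w + t *: u w) -[X in X <=L _](addr0 _).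
    by apply: bl_leD; [exact: yu|apply: bl_scale_ge0 => //; exact: ltW].
  rewrite pD ?pZ//; last exact: KZ.
  by rewrite pc0 /t divfK ?lt_eqF//; lra.
(* All weights have to be positive: the types other than i get weight t -> 0. *)
have pP i u : K u -> P i u -> p (a i) <= p u.
  move=> Ku Pu; apply/ler_addgt0Pr => e e0.
  pose s := \sum_(j | j != i) p (b j - a j).
  pose t := e / (1 + `|s|).
  have s1 : 0 < 1 + `|s| by rewrite ltr_pwDl.
  have t0 : 0 < t by rewrite divr_gt0.
  have ts : t * s <= e.
    rewrite /t mulrAC ler_pdivrMr// ler_pM2l//.
    by apply: le_trans (ler_norm _) _; rewrite lerDr.
  pose l j : R := if j == i then 1 else t.
  pose y j : V := if j == i then u else b j.
  have Ky j : K (y j) by rewrite /y; case: ifP.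
  have Kly j : K (l j *: (y j - a j)) by apply: KZ; apply: KD => //; exact: KN.
  have : 0 <= p (\sum_j l j *: (y j - a j)).
    apply: pC; last exact: Ksum.
    exists l, y; split=> [j|j|w]; rewrite /l /y.
    - by case: ifP.
    - by case: eqP => [->|].
    - by rewrite sumE; exact: bl_le_refl.
  rewrite psum// (bigD1 i)//= /l /y eqxx scale1r pB//.
  rewrite (eq_bigr (fun j => t * p (b j - a j))); last first.
    by move=> j /negPf ->; rewrite pZ.
  by rewrite -mulr_sumr -/s; move: ts; lra.
have ax i : p (a i) <= p (x i).
  apply/ler_addgt0Pr => e e0.
  have ph0 : 0 <= p h by apply: ppos.
  pose t := e / (1 + p h).
  have t1 : 0 < 1 + p h by rewrite ltr_pwDl.
  have t0 : 0 < t by rewrite divr_gt0.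
  have Kth : K (t *: h) by apply: KZ.
  apply: le_trans (pP i (x i + t *: h) _ _) _; [exact: KD|exact: P_monotone|].
  rewrite pD// pZ// lerD2l /t mulrAC ler_pdivrMr// ler_pM2l//; lra.
have xa : p (\sum_i x i) <= p (\sum_i a i).
  rewrite -subr_ge0 -pB; [|exact: Ksum..].
  apply: ppos; first by apply: KD; [exact: Ksum|apply: KN; exact: Ksum].
  move=> w; rewrite -[_ w]/((\sum_i a i) w - (\sum_i x i) w) bl_subr_ge0 !sumE.
  exact: x_feasible.
have px i : p (x i) = p (a i).
  apply/eqP; rewrite eq_le ax andbT leNgt; apply/negP => lt.
  move: xa; rewrite !psum// leNgt => /negP; apply.
  by rewrite (bigD1 i)//= [ltRHS](bigD1 i)//= ltr_leD// ler_sum.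
exists p; split=> //.
split; first by rewrite !psum//; apply: eq_bigr.
have Ks : K (\sum_i a i) by exact: Ksum.
have [c cgt0 c0c] := h_unit Kc0; have [d d0 hd] := h_le_a.
have cd : 0 < c * d by rewrite mulr_gt0.
have : 0 <= p ((c * d) *: \sum_i a i - c0).
  apply: ppos; first by apply: KD; [exact: KZ|exact: KN].
  move=> w; rewrite -[_ w]/((c * d) *: (\sum_i a i) w - c0 w) bl_subr_ge0 sumE.
  by rewrite -scalerA; apply: bl_trans (c0c w) _; apply: bl_leZ => //; exact: ltW.
rewrite pB//; last exact: KZ.
rewrite pZ// pc0 subr_ge0 => h1.
by rewrite -(pmulr_rgt0 _ cd); apply: lt_le_trans h1.
Qed.

End supporting_functional.

(** * Continuous supports from properness *)

Section proper_support.
Context (R : realType) (Y : normedModType R) (Omega : finType).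
Local Notation V := (Omega -> Y).
Variables (D Q : set V) (p : V -> R) (z0 : V) (eps beta : R).
Implicit Types (u v z : V).
Hypothesis D0 : D 0.
Hypothesis DD : forall u v, D u -> D v -> D (u + v).
Hypothesis DZ : forall (t : R) u, 0 < t -> D u -> D (t *: u).
Hypothesis pD : forall u v, D u -> D v -> p (u + v) = p u + p v.
Hypothesis pZ : forall (t : R) u, 0 < t -> D u -> p (t *: u) = t * p u.
Hypothesis Q_convex : forall (s t : R) u v, 0 < s -> 0 < t -> s + t = 1 ->
  Q u -> Q v -> Q (s *: u + t *: v).
Hypothesis eps0 : 0 < eps.
Hypothesis Q_ball : forall z, (forall w, `|z0 w - z w| < eps) -> Q z.
Hypothesis Dz0 : D z0.
Hypothesis Qp : forall z, Q z -> D z -> beta <= p z.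

(** C is the cone generated by the differences of points (z', s') with z' in D and
    s' >= p z' and points (z, s) with z in Q and s < beta, where the first
    coordinate of the difference is taken with the opposite sign. It avoids 0
    since Q lies above beta on D, and (0, g), with
    z = z' = z0, is internal because a norm ball around z0 lies in Q. Since that
    point is vertical, the separating hyperplane is the graph of a functional,
    and the ball makes it bounded. *)
Lemma proper_support : exists q : V -> R,
  [/\ (forall u v, q (u + v) = q u + q v) /\ (forall c u, q (c *: u) = c * q u),
      exists2 M : R, 0 <= M & forall v r, 0 <= r ->
        (forall w, `|v w| <= r) -> q v <= M * r,
      forall z, Q z -> beta <= q z &
      forall z, D z -> q z <= p z].
Proof.
have Qz0 : Q z0 by apply: Q_ball => w; rewrite subrr normr0.
pose W := (V * R^o)%type.
pose el t z z' r : W := (t *: z - z', p z' - t * beta + r).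
pose C : set W := [set w | exists t z z' r, [/\ 0 < t, Q z, D z', 0 < r &
  w = el t z z' r]].
have C_cone : convex_cone C.
  split.
    move=> _ _ [t [z [z' [r [t0 Qz Dz r0 ->]]]]] [s [y [y' [r' [s0 Qy Dy r'0 ->]]]]].
    have st0 : 0 < t + s by rewrite addr_gt0.
    exists (t + s), ((t / (t + s)) *: z + (s / (t + s)) *: y), (z' + y'), (r + r').
    split; rewrite ?addr_gt0//.
    - apply: Q_convex => //; [exact: divr_gt0|exact: divr_gt0|].
      by rewrite -mulrDl divff// gt_eqF.
    - exact: DD.
    rewrite /el; congr pair => /=.
      rewrite scalerDr !scalerA ![(t + s) * _]mulrC !divfK ?gt_eqF//.
      by rewrite addrACA opprD.
    by rewrite pD// mulrDl; ring.
  move=> s _ s0 [t [z [z' [r [t0 Qz Dz r0 ->]]]]].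
  exists (s * t), z, (s *: z'), (s * r); split; rewrite ?mulr_gt0//; first exact: DZ.
  rewrite /el; congr pair => /=; first by rewrite scalerBr scalerA.
  by rewrite pZ// -[LHS]/(s * (p z' - t * beta + r)); ring.
have nC0 : ~ C 0.
  move=> [t [z [z' [r [t0 Qz Dz r0 []]]]]] /esym/eqP.
  rewrite subr_eq0 => /eqP tz pE.
  have zE : z = t^-1 *: z' by rewrite -tz scalerA mulVf ?gt_eqF// scale1r.
  have Dz1 : D z by rewrite zE; apply: DZ => //; rewrite invr_gt0.
  have := Qp Qz Dz1; rewrite -(ler_pM2l t0) -pZ// tz => h.
  by move: pE h; lra.
pose g := p z0 - beta + 1.
have g1 : 1 <= g by have := Qp Qz0 Dz0; rewrite /g; lra.
have g0 : 0 < g by apply: lt_le_trans g1.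
pose c0 : W := (0, g).
have Cc0 : C c0.
  exists 1, z0, z0, 1; split=> //; rewrite /el scale1r subrr mul1r //.
have Cint w : setT w -> exists t, C (w + t *: c0).
  case: w => v s _.
  (* v / T moves z0 by less than eps, and T + s > 0 *)
  pose T := 1 + `|s| + (\sum_w `|v w|) / eps.
  have S0 : 0 <= \sum_w `|v w| by apply: sumr_ge0.
  have Seps : 0 <= (\sum_w `|v w|) / eps by rewrite divr_ge0// ltW.
  have T0 : 0 < T by rewrite /T; have := normr_ge0 s; lra.
  exists T, T, (z0 + T^-1 *: v), (T *: z0), (s + T); split=> //.
  - apply: Q_ball => w; rewrite -[(z0 + _) w]/(z0 w + T^-1 *: v w).
    rewrite opprD addrA subrr sub0r normrN normrZ gtr0_norm ?invr_gt0//.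
    rewrite ltr_pdivrMl//; apply: (@le_lt_trans _ _ (\sum_w `|v w|)).
      by rewrite (bigD1 w)//= lerDl; apply: sumr_ge0.
    by rewrite -ltr_pdivrMr// /T; have := normr_ge0 s; lra.
  - exact: DZ.
  - by rewrite /T; have := ler_norm (- s); rewrite normrN; lra.
  rewrite /el /c0; congr pair => /=.
    by rewrite scaler0 addr0 scalerDr scalerA divff ?gt_eqF// scale1r addrC addKr.
  by rewrite pZ// -[LHS]/(s + T * g) /g; ring.
have [phi [phiD phiZ phiC phic0]] :=
  cone_separation C_cone nC0 Cc0 (I : setT c0) (fun _ _ _ _ => I) (fun _ _ _ => I) Cint.
have {}phiD (u v : W) : phi (u + v) = phi u + phi v by exact: phiD.
have {}phiZ c (u : W) : phi (c *: u) = c * phi u by exact: phiZ.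
have {}phiC (c : W) : C c -> 0 <= phi c by move=> /phiC; exact.
pose q v := phi (v, 0) * g.
have qD u v : q (u + v) = q u + q v.
  by rewrite /q -mulrDl -phiD; congr (phi (pair _ _) * _); rewrite /= addr0.
have qZ c v : q (c *: v) = c * q v.
  by rewrite /q mulrA -phiZ; congr (phi (pair _ _) * _); rewrite /= scaler0.
have phiE v s : phi (v, s) * g = q v + s.
  have -> : (v, s) = (v, 0) + (s / g) *: c0.
    by congr pair; rewrite /= ?scaler0 ?addr0// add0r -[RHS]/(s / g * g) divfK ?gt_eqF.
  by rewrite phiD phiZ phic0 mulr1 mulrDl divfK ?gt_eqF.
have qC t z z' r : 0 < t -> Q z -> D z' -> 0 < r ->
    0 <= t * q z - q z' + (p z' - t * beta + r).
  move=> t0 Qz Dz' r0.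
  have : 0 <= phi (el t z z' r) * g.
    by apply: mulr_ge0; [apply: phiC; exists t, z, z', r|exact: ltW].
  by rewrite phiE qD -scaleN1r !qZ mulN1r.
have q0 : q 0 = 0 by rewrite -(scale0r 0) qZ mul0r.
have p0 : p 0 = 0.
  by have := pD D0 D0; rewrite addr0 => /eqP; rewrite eq_sym -subr_eq0 addrK => /eqP.
have qQ z : Q z -> beta <= q z.
  move=> Qz; apply/ler_addgt0Pr => e e0.
  by have := qC 1 z 0 e ltr01 Qz D0 e0; rewrite q0 p0; lra.
have qz0 := qQ _ Qz0.
exists q; split=> //.
- exists (2 * (q z0 - beta) / eps) => [|v r].
    by rewrite divr_ge0 ?mulr_ge0 ?subr_ge0// ltW.
  rewrite le_eqVlt => /orP[/eqP<-|r0] vr.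
    have -> : v = 0 by apply/funext => w; apply/eqP; rewrite -normr_le0.
    by rewrite q0 mulr0.
  pose s := eps / (2 * r).
  have s0 : 0 < s by rewrite divr_gt0// mulr_gt0.
  have : beta <= q (z0 - s *: v).
    apply: qQ; apply: Q_ball => w; rewrite -[(z0 - _) w]/(z0 w - s *: v w).
    rewrite opprB addrC subrK normrZ gtr0_norm//.
    apply: (@le_lt_trans _ _ (s * r)); first by rewrite ler_pM2l.
    rewrite /s; apply: (@le_lt_trans _ _ (eps / 2)).
      by rewrite invfM mulrA divfK ?gt_eqF.
    by rewrite ltr_pdivrMr// ltr_pMr// ltr1n.
  rewrite qD -scaleN1r !qZ mulN1r => h.
  have : s * q v <= q z0 - beta by lra.
  rewrite mulrC -ler_pdivlMr// => /le_trans; apply.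
  by rewrite /s invf_div le_eqVlt; apply/orP; left; apply/eqP; field; rewrite gt_eqF.
- move=> z Dz; apply/ler_addgt0Pr => e e0.
  pose t := e / (1 + (q z0 - beta)).
  have d1 : 0 < 1 + (q z0 - beta) by lra.
  have t0 : 0 < t by rewrite divr_gt0.
  have te : t * (1 + (q z0 - beta)) = e by rewrite /t divfK// gt_eqF.
  by have := qC t z0 z t t0 Qz0 Dz t0; move: te; rewrite mulrDr mulr1 mulrBr; lra.
Qed.

End proper_support.

(** * Extension to a continuous price system *)

Section bump.
Context (R : realType) (Y : lmodType R) (Omega : finType).
Implicit Types (A : {set Omega}) (y : Y) (u : Omega -> Y).

Definition bump A y : Omega -> Y := fun w => if w \in A then y else 0.

Definition restr A u : Omega -> Y := fun w => if w \in A then u w else 0.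

Lemma bumpD A y z : bump A (y + z) = bump A y + bump A z.
Proof.
by apply/funext => w; rewrite -[RHS]/(bump A y w + bump A z w) /bump;
  case: ifP; rewrite ?addr0.
Qed.

Lemma bumpZ A (c : R) y : bump A (c *: y) = c *: bump A y.
Proof.
by apply/funext => w; rewrite -[RHS]/(c *: bump A y w) /bump; case: ifP; rewrite ?scaler0.
Qed.

Lemma sum_bump A y : bump A y = \sum_(w in A) bump [set w]%SET y.
Proof.
apply/funext => w; rewrite fct_sumE /bump; have [wA|wA] := ifPn.
  rewrite (bigD1 w)//= finset.in_set1 eqxx big1 ?addr0// => v /andP[_ vw].
  by rewrite finset.in_set1 eq_sym (negPf vw).
rewrite big1// => v vA; rewrite finset.in_set1.
by case: eqP => // wv; rewrite wv vA in wA.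
Qed.

Lemma sum_bump1 u : u = \sum_w bump [set w]%SET (u w).
Proof.
apply/funext => w; rewrite fct_sumE /bump (bigD1 w)//= finset.in_set1 eqxx.
rewrite big1 ?addr0// => v vw; by rewrite finset.in_set1 eq_sym (negPf vw).
Qed.

Lemma sum_restr (P : {set {set Omega}}) u :
  finset.partition P [set: Omega]%SET -> u = \sum_(A in P) restr A u.
Proof.
move=> partP; have /and3P[/eqP covP trivP _] := partP.
apply/funext => w; rewrite fct_sumE.
have wP : w \in finset.cover P by rewrite covP finset.in_setT.
rewrite (bigD1 (finset.pblock P w)) ?finset.pblock_mem//= /restr finset.mem_pblock wP.
rewrite big1 ?addr0// => A /andP[AP nA]; case: ifP => // wA.
by rewrite (finset.def_pblock trivP AP wA) eqxx in nA.
Qed.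

Lemma restr_bump (P : {set {set Omega}}) A w u : info_measurable P u ->
  A \in P -> w \in A -> restr A u = bump A (u w).
Proof.
move=> uP AP wA; apply/funext => v; rewrite /restr /bump; case: ifP => // vA.
exact: uP AP vA wA.
Qed.

Lemma bump_info_measurable (P : {set {set Omega}}) A y :
  finset.partition P [set: Omega]%SET -> A \in P -> info_measurable P (bump A y).
Proof.
move=> /and3P[_ trivP _] AP B w w' BP wB w'B; rewrite /bump.
have E v : v \in B -> (v \in A) = (A == B).
  move=> vB; apply/idP/eqP => [vA|->//].
  by rewrite -(finset.def_pblock trivP AP vA) (finset.def_pblock trivP BP vB).
by rewrite !E.
Qed.

End bump.

Lemma continuous_sum (R : realType) (Y : normedModType R) (I : finType)
    (F : I -> Y -> R^o) : (forall i, continuous (F i)) ->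
  continuous (fun z => \sum_i F i z : R^o).
Proof.
move=> cF; elim: (index_enum I) => [|i s IH].
  rewrite (_ : (fun _ => _) = cst 0); first exact: cst_continuous.
  by apply/funext => z; rewrite big_nil.
rewrite (_ : (fun _ => _) = F i \+ (fun z => \sum_(j <- s) F j z)).
  by move=> z; apply: cvgD; [exact: cF|exact: IH].
by apply/funext => z; rewrite big_cons.
Qed.

Section price_extension.
Context (R : realType) (Y : banachLatticeType R) (Omega : finType) (I : finType).
Local Notation V := (Omega -> Y).
Variables (J : set Y) (P : I -> {set {set Omega}}) (e : V) (x : I -> V).
Variables (p : V -> R) (q : I -> V -> R) (M : I -> R).
Implicit Types (i : I) (u v : V) (y z : Y) (A : {set Omega}).
Local Notation K := [set u : V | forall w, J (u w)].
Hypothesis partP : forall i, finset.partition (P i) [set: Omega]%SET.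
Hypothesis J_ideal : order_ideal J.
Hypothesis e_unit : forall w z, J z -> exists2 c : R, 0 < c & z <=L c *: e w.
Hypothesis Je : forall w, J (e w).
Hypothesis pD : forall u v, K u -> K v -> p (u + v) = p u + p v.
Hypothesis pZ : forall (c : R) u, K u -> p (c *: u) = c * p u.
Hypothesis p_ge0 : forall u, K u -> (forall w, 0 <=L u w) -> 0 <= p u.
Hypothesis x_ge0 : forall i w, 0 <=L x i w.
Hypothesis x_info : forall i, info_measurable (P i) (x i).
Hypothesis x_feasible : forall w, \sum_i x i w <=L e w.
Hypothesis x_value : p (\sum_i x i) = p e.
Hypothesis qD : forall i u v, q i (u + v) = q i u + q i v.
Hypothesis qZ : forall i c u, q i (c *: u) = c * q i u.
Hypothesis M_ge0 : forall i, 0 <= M i.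
Hypothesis q_bound : forall i v r, 0 <= r ->
  (forall w, `|v w| <= r) -> q i v <= M i * r.
Hypothesis q_le_p : forall i u, K u -> (forall w, 0 <=L u w) ->
  info_measurable (P i) u -> q i u <= p u.
Hypothesis qx : forall i, q i (x i) = p (x i).

Let J0 : J 0. Proof. by case: J_ideal. Qed.
Let JD y z : J y -> J z -> J (y + z). Proof. by case: J_ideal => _ h _ _; exact: h. Qed.
Let JZ (c : R) y : J y -> J (c *: y). Proof. by case: J_ideal => _ _ h _; exact: h. Qed.
Let Jle y z : 0 <=L y -> y <=L z -> J z -> J y.
Proof. by case: J_ideal => _ _ _ h; exact: h. Qed.
Let JN y : J y -> J (- y). Proof. by rewrite -scaleN1r; exact: JZ. Qed.

Let Jx i w : J (x i w).
Proof.
apply: (Jle (x_ge0 i w) _ (Je w)); apply: bl_trans (x_feasible w).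
exact: (bl_le_sum (F := fun i => x i w)).
Qed.

Let Kbump A y : J y -> K (bump A y).
Proof. by move=> Jy w; rewrite /bump; case: ifP. Qed.

Let bump_ge0 A y : 0 <=L y -> forall w, 0 <=L bump A y w.
Proof. by move=> y0 w; rewrite /bump; case: ifP => // _; exact: bl_le_refl. Qed.

Let p0 : p 0 = 0.
Proof. by rewrite -(scale0r 0) pZ ?mul0r. Qed.

Let p_sum (S : finType) (B : pred S) (F : S -> V) : (forall s, B s -> K (F s)) ->
  p (\sum_(s | B s) F s) = \sum_(s | B s) p (F s).
Proof.
move=> KF; suff [] : K (\sum_(s | B s) F s) /\
    p (\sum_(s | B s) F s) = \sum_(s | B s) p (F s) by [].
elim/big_ind2: _ => // [|u r v s [Ku <-] [Kv <-]|s Bs]; last by split=> //; exact: KF.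
  by split.
by split; [move=> w; exact: JD|exact: pD].
Qed.

Let q_sum i (S : finType) (B : pred S) (F : S -> V) :
  q i (\sum_(s | B s) F s) = \sum_(s | B s) q i (F s).
Proof.
apply: (big_morph (q i)); first exact: qD.
by rewrite -(scale0r 0) qZ mul0r.
Qed.

Let ps w y := p (bump [set w]%SET y).

Let psD w y z : J y -> J z -> ps w (y + z) = ps w y + ps w z.
Proof. by move=> Jy Jz; rewrite /ps bumpD pD//; exact: Kbump. Qed.

Let psZ w c y : J y -> ps w (c *: y) = c * ps w y.
Proof. by move=> Jy; rewrite /ps bumpZ pZ//; exact: Kbump. Qed.

Let ps_ge0 w y : J y -> 0 <=L y -> 0 <= ps w y.
Proof. by move=> Jy y0; apply: p_ge0; [exact: Kbump|exact: bump_ge0]. Qed.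

Let ps_mono w y z : 0 <=L y -> y <=L z -> J z -> ps w y <= ps w z.
Proof.
move=> y0 yz Jz; have Jy := Jle y0 yz Jz.
rewrite -[z](subrK y) psD//; last by apply: JD => //; exact: JN.
rewrite lerDr; apply: ps_ge0; last by rewrite bl_subr_ge0.
by apply: JD => //; exact: JN.
Qed.

Let p_bump A y : J y -> p (bump A y) = \sum_(w in A) ps w y.
Proof. by move=> Jy; rewrite sum_bump p_sum// => w _; exact: Kbump. Qed.

Let pE u : K u -> p u = \sum_w ps w (u w).
Proof.
by move=> Ku; rewrite {1}(sum_bump1 u) p_sum// => w _; apply: Kbump; exact: Ku.
Qed.

Let qb i A y := q i (bump A y).

Let qbD i A y z : qb i A (y + z) = qb i A y + qb i A z.
Proof. by rewrite /qb bumpD qD. Qed.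

Let qbZ i A c y : qb i A (c *: y) = c * qb i A y.
Proof. by rewrite /qb bumpZ qZ. Qed.

Let qb_bound i A y : qb i A y <= M i * `|y|.
Proof. by apply: q_bound => // w; rewrite /bump; case: ifP => // _; rewrite normr0. Qed.

Let qb_le i A y : A \in P i -> J y -> 0 <=L y -> qb i A y <= \sum_(w in A) ps w y.
Proof.
move=> AP Jy y0; rewrite -p_bump//; apply: q_le_p; [exact: Kbump|exact: bump_ge0|].
exact: bump_info_measurable.
Qed.

(* Summed over the blocks the inequality q i <= p is an equality at x i, so it
   is one on each block. *)
Let qb_x i A w : A \in P i -> w \in A ->
  qb i A (x i w) = \sum_(v in A) ps v (x i w).
Proof.
move=> AP wA; rewrite /qb -p_bump// -!(restr_bump (x_info (i := i)) AP wA).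
have Kr B : K (restr B (x i)) by move=> v; rewrite /restr; case: ifP => // _; exact: Jx.
have le B : B \in P i -> q i (restr B (x i)) <= p (restr B (x i)).
  move=> BP; have /and3P[_ _ nP0] := partP i.
  have /finset.set0Pn[v vB] : B != finset.set0.
    by apply: contraNneq nP0 => <-.
  rewrite (restr_bump (x_info (i := i)) BP vB); apply: q_le_p.
  - by apply: Kbump; exact: Jx.
  - exact: bump_ge0.
  - exact: bump_info_measurable.
have E : \sum_(B in P i) q i (restr B (x i)) = \sum_(B in P i) p (restr B (x i)).
  by rewrite -q_sum -p_sum// -(sum_restr (x i) (partP i)).
apply/eqP; rewrite eq_le le//= leNgt; apply/negP => lt.
have : \sum_(B in P i) q i (restr B (x i)) < \sum_(B in P i) p (restr B (x i)).
  rewrite (bigD1 A)//= [ltRHS](bigD1 A)//= ltr_leD// ler_sum// => B /andP[BP _].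
  exact: le.
by rewrite E ltxx.
Qed.

(* The constant must not depend on the multiple c: it has to serve on the whole
   ideal generated by y. *)
Let bounded_below w y := exists2 C : R, 0 <= C & forall c z, 0 < c ->
  0 <=L z -> z <=L c *: y -> ps w z <= C * `|z|.

(* qb i A <= p on the block A with equality at x i w, hence equality on every
   [0, c x i w]; and ps w is one of the positive summands of p on the block. *)
Let bounded_x i w : bounded_below w (x i w).
Proof.
exists (M i) => // c z c0 z0 zx.
have Jcx : J (c *: x i w) by exact: JZ.
have Jz : J z := Jle z0 zx Jcx.
have /and3P[/eqP covP _ _] := partP i.
have wc : w \in finset.cover (P i) by rewrite covP finset.in_setT.
pose A := finset.pblock (P i) w.
have AP : A \in P i by exact: finset.pblock_mem.
have wA : w \in A by rewrite finset.mem_pblock.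
have Jd : J (c *: x i w - z) by apply: JD => //; exact: JN.
have le2 := qb_le AP Jd (_ : 0 <=L _ - _); rewrite bl_subr_ge0 in le2.
have {}le2 := le2 zx.
have eqx : qb i A (c *: x i w) = \sum_(v in A) ps v (c *: x i w).
  rewrite qbZ qb_x// mulr_sumr; apply: eq_bigr => v _; rewrite psZ//.
have E : qb i A (c *: x i w - z) = qb i A (c *: x i w) - qb i A z.
  by rewrite qbD -(scaleN1r z) (qbZ _ _ (- 1)) mulN1r.
have F : \sum_(v in A) ps v (c *: x i w - z) =
    \sum_(v in A) ps v (c *: x i w) - \sum_(v in A) ps v z.
  rewrite -sumrB; apply: eq_bigr => v _.
  by rewrite psD ?psZ//; [rewrite -(scaleN1r z) (psZ _ (- 1))// mulN1r|exact: JN].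
apply: le_trans (qb_bound i A z); apply: (@le_trans _ _ (\sum_(v in A) ps v z)).
  by rewrite (bigD1 w)//= lerDl; apply: sumr_ge0 => v _; exact: ps_ge0.
by move: le2; rewrite E F eqx; lra.
Qed.

(* ps w vanishes at this element, by complementary slackness. *)
Let bounded_d w : bounded_below w (e w - \sum_i x i w).
Proof.
pose d w := e w - \sum_i x i w.
have Jd (v : Omega) : J (d v).
  apply: JD => //; apply: JN; apply: (Jle _ (x_feasible v) (Je v)).
  by apply: bl_sum_ge0.
have d_ge0 (v : Omega) : 0 <=L d v by rewrite bl_subr_ge0.
have pd : p d = 0.
  have -> : d = e - \sum_i x i.
    by apply/funext => v; rewrite /d -[RHS]/(e v - (\sum_i x i) v) fct_sumE.
  have Ks : K (\sum_i x i).
    move=> v; rewrite fct_sumE; apply: (Jle _ (x_feasible v) (Je v)).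
    by apply: bl_sum_ge0.
  rewrite pD//; last by move=> v; apply: JN; exact: Ks.
  by rewrite -scaleN1r pZ// x_value mulN1r subrr.
have psd : ps w (d w) = 0.
  have := pd; rewrite pE// => /eqP; rewrite psumr_eq0 => [/allP/(_ w)|v _].
    by rewrite mem_index_enum => /(_ isT)/eqP.
  exact: ps_ge0.
exists 0 => // c z c0 z0 zd; rewrite mul0r.
rewrite -/(d w) in zd.
apply: le_trans (ps_mono w z0 zd _) _; first exact: JZ.
by rewrite psZ// psd mulr0.
Qed.

Let boundedD w y z : J y -> J z -> 0 <=L y -> 0 <=L z ->
  bounded_below w y -> bounded_below w z -> bounded_below w (y + z).
Proof.
move=> Jy Jz y0 z0 [C C0 Cy] [D D0 Dz]; exists (C + D); first exact: addr_ge0.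
move=> c t c0 t0; rewrite scalerDr => tle.
have cy0 : 0 <=L c *: y by apply: bl_scale_ge0 => //; exact: ltW.
have cz0 : 0 <=L c *: z by apply: bl_scale_ge0 => //; exact: ltW.
have [u [v [tE u0 uy v0 vz]]] := riesz_decomposition t0 cy0 cz0 tle.
have Ju : J u by apply: Jle uy _ => //; exact: JZ.
have Jv : J v by apply: Jle vz _ => //; exact: JZ.
have ut : u <=L t by rewrite tE -bl_subr_ge0 addrAC subrr add0r.
have vt : v <=L t by rewrite tE -bl_subr_ge0 addrK.
rewrite {1}tE psD// mulrDl; apply: lerD.
  by apply: le_trans (Cy _ _ c0 u0 uy) _; rewrite ler_wpM2l// bl_norm_mono.
by apply: le_trans (Dz _ _ c0 v0 vz) _; rewrite ler_wpM2l// bl_norm_mono.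
Qed.

Let bounded_e w : exists2 C : R, 0 <= C &
  forall z, J z -> 0 <=L z -> ps w z <= C * `|z|.
Proof.
have [C C0 eC] : bounded_below w (e w).
  rewrite -(subrK (\sum_i x i w) (e w)).
  have [Js s0 bs] : [/\ J (\sum_i x i w), 0 <=L \sum_i x i w &
      bounded_below w (\sum_i x i w)].
    elim/big_ind: _ => [|u v [Ju u0 bu] [Jv v0 bv]|i _]; split=> //.
    - exact: bl_le_refl.
    - exists 0 => // c z _ z0; rewrite scaler0 => zle.
      have -> : z = 0 by apply: bl_le_anti; rewrite zle z0.
      by rewrite -(scale0r 0) psZ// !mul0r.
    - exact: JD.
    - exact: bl_addr_ge0.
    - exact: boundedD.
  apply: boundedD => //; first by apply: JD => //; exact: JN.
  by rewrite bl_subr_ge0.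
exists C => // z Jz z0; have [c c0 zc] := e_unit w Jz.
exact: eC c0 z0 zc.
Qed.

Let pbar_exists w : exists pb : {linear Y -> R^o},
  pos_dual pb /\ forall z, J z -> 0 <=L z -> pb z = ps w z.
Proof.
have [C C0 bC] := bounded_e w.
have [pb [pbd pbge pble]] := riesz_kantorovich J_ideal C0 (psD w) (psZ w) bC.
exists pb; split=> // z Jz z0; apply/eqP; rewrite eq_le; apply/andP; split.
  by apply: pble => // y Jy y0 yz; exact: ps_mono.
by apply: pbge => //; exact: bl_le_refl.
Qed.

(** State w is priced by the least extension of ps w plus, for each i, the
    positive part r of the excess of q i over the extensions on the block of w.
    On J that excess is at most 0, hence r = 0 there. *)
Lemma price_extension : exists pi : Omega -> {linear Y -> R^o},
  [/\ forall w, pos_dual (pi w),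
      forall u, K u -> (forall w, 0 <=L u w) -> price_value pi u = p u &
      forall i u, (forall w, 0 <=L u w) -> info_measurable (P i) u ->
        q i u <= price_value pi u].
Proof.
have [pb pbP] := choice pbar_exists.
have pb_ge0 w z : 0 <=L z -> 0 <= pb w z.
  by move=> z0; case: (pbP w) => [[_ h] _]; exact: h.
have /choice[r rP] (k : I * {set Omega}) : exists r : {linear Y -> R^o},
    [/\ pos_dual r,
     forall z, 0 <=L z -> qb k.1 k.2 z <= \sum_(w in k.2) pb w z + r z &
     k.2 \in P k.1 -> forall z, J z -> 0 <=L z -> r z = 0].
  case: k => i A /=; pose g z := qb i A z - \sum_(w in A) pb w z.
  have T_ideal : order_ideal [set: Y] by split.
  have gD y z : setT y -> setT z -> g (y + z) = g y + g z.
    move=> _ _; rewrite /g qbD (eq_bigr (fun w => pb w y + pb w z)) => [|w _].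
      by rewrite big_split /= opprD addrACA.
    exact: linearD.
  have gZ c z : setT z -> g (c *: z) = c * g z.
    move=> _; rewrite /g qbZ mulrBr mulr_sumr; congr (_ - _).
    by apply: eq_bigr => w _; exact: linearZ.
  have gM z : setT z -> 0 <=L z -> g z <= M i * `|z|.
    move=> _ z0; apply: le_trans (qb_bound i A z); rewrite /g gerBl.
    by apply: sumr_ge0 => w _; exact: pb_ge0.
  have [r [rd rge rle]] := riesz_kantorovich T_ideal (M_ge0 i) gD gZ gM.
  exists r; split=> // [z z0|AP z Jz z0].
    by rewrite addrC -lerBlDr; apply: rge => //; exact: bl_le_refl.
  apply/eqP; rewrite eq_le; apply/andP; split; last by case: rd => _; exact.
  apply: rle => // y _ y0 yz; rewrite /g subr_le0.
  have Jy := Jle y0 yz Jz.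
  apply: le_trans (qb_le AP Jy y0) _.
  by apply: ler_sum => w _; case: (pbP w) => _ ->.
pose pif w z : R := pb w z + \sum_i r (i, finset.pblock (P i) w) z.
have pif_lin w : linear (pif w : Y -> R^o).
  move=> c y z; rewrite /pif linearP.
  rewrite (eq_bigr (fun i => c *: (r (i, finset.pblock (P i) w) y : R^o) +
    r (i, finset.pblock (P i) w) z)) => [|i _]; last exact: linearP.
  by rewrite big_split /= -scaler_sumr scalerDr addrACA.
pose pi w : {linear Y -> R^o} := linear_of (pif_lin w).
have piE w z : pi w z = pif w z by [].
have rpos k z : 0 <=L z -> 0 <= r k z.
  by move=> z0; case: (rP k) => [[_ h] _ _]; exact: h.
have pblockE i A w : A \in P i -> w \in A -> finset.pblock (P i) w = A.
  by move=> AP wA; have /and3P[_ trivP _] := partP i; exact: finset.def_pblock.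
have pblockP i w : finset.pblock (P i) w \in P i.
  by apply: finset.pblock_mem; have /and3P[/eqP-> _ _] := partP i; rewrite finset.in_setT.
exists pi; split.
- move=> w; split; last first.
    by move=> z z0; rewrite piE addr_ge0 ?pb_ge0// sumr_ge0// => i _; exact: rpos.
  move=> z; apply: cvgD; first by case: (pbP w) => -[c _] _; exact: c.
  apply: (continuous_sum (F := fun i => r (i, finset.pblock (P i) w))) => i.
  by case: (rP (i, finset.pblock (P i) w)) => -[].
- move=> u Ku u0; rewrite pE//; apply: eq_bigr => w _; rewrite piE /pif.
  rewrite big1 ?addr0; first by case: (pbP w) => _ ->.
  by move=> i _; case: (rP (i, finset.pblock (P i) w)) => _ _ /= -> //.
- move=> i u u0 uP.
  have -> : price_value pi u = \sum_(A in P i) \sum_(w in A) pi w (u w).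
    rewrite -(finset.set_partition_big _ (partP i)).
    by apply: eq_bigl => w; rewrite finset.in_setT.
  rewrite [in leLHS](sum_restr u (partP i)) q_sum; apply: ler_sum => A AP.
  have /and3P[_ _ nP0] := partP i.
  have /finset.set0Pn[v vA] : A != finset.set0 by apply: contraNneq nP0 => <-.
  rewrite (restr_bump uP AP vA) -/(qb i A (u v)).
  have [_ /(_ _ (u0 v)) le _] := rP (i, A); apply: le_trans le _ => /=.
  (* the correction of the block is counted once, at its state v *)
  pose rv w := if w == v then r (i, A) (u v) else 0.
  apply: (@le_trans _ _ (\sum_(w in A) (pb w (u v) + rv w))).
    rewrite /rv big_split /= lerD2l (bigD1 v)//= eqxx lerDl.
    by rewrite sumr_ge0// => w /andP[_ /negPf ->].
  apply: ler_sum => w wA; rewrite (uP _ _ _ AP wA vA) piE /pif /rv lerD2l.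
  rewrite (bigD1 i)//= (pblockE _ _ _ AP wA).
  have := rpos (i, A) _ (u0 v).
  have : 0 <= \sum_(j | j != i) r (j, finset.pblock (P j) w) (u v).
    by apply: sumr_ge0 => j _; exact: rpos.
  by case: ifP => _; lra.
Qed.

End price_extension.

Lemma convex_setD (R : realType) (V : lmodType R) (A : set (convex_lmodType V))
    (s t : R) (u v : V) : convex_set A -> 0 < s -> 0 < t -> s + t = 1 ->
  A u -> A v -> A (s *: u + t *: v).
Proof.
move=> cA s0 t0 st Au Av.
have s1 : s <= 1 by rewrite -st lerDl ltW.
have -> : t = 1 - s by rewrite -st addrAC subrr add0r.
exact: set_mem (cA u v (Itv01 (ltW s0) s1) (mem_set Au) (mem_set Av)).
Qed.

(** * Order ideals and expected utility *)

Section unit_ideal.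
Context (R : realType) (Y : banachLatticeType R).
Implicit Types (h x y z : Y).

(** The principal ideal of h for h >= 0, with real instead of integer multiples. *)
Definition unit_ideal h : set Y := [set z | exists c : R, labs z <=L c *: h].

Lemma unit_ideal_pos h z : 0 <=L h -> unit_ideal h z ->
  exists2 c : R, 0 < c & labs z <=L c *: h.
Proof.
move=> h0 [c zc]; exists (1 + `|c|); first by rewrite ltr_pwDl.
by apply: bl_trans zc _; apply: bl_leZl => //; rewrite ler_wpDl// ler_norm.
Qed.

Lemma unit_ideal_order_ideal h : 0 <=L h -> order_ideal (unit_ideal h).
Proof.
move=> h0; split.
- by exists 0; rewrite scale0r ger0_labs ?bl_le_refl.
- move=> x y [c xc] [d yd]; exists (c + d); rewrite labs_le scalerDl opprD.
  apply/andP; split; apply: bl_leD.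
  + exact: bl_trans (labs_ge x) xc.
  + exact: bl_trans (labs_ge y) yd.
  + exact: bl_trans (labs_geN x) xc.
  + exact: bl_trans (labs_geN y) yd.
- move=> a x /(unit_ideal_pos h0)[c c0 xc]; exists (`|a| * c); rewrite -scalerA.
  apply: bl_trans (bl_leZ (normr_ge0 a) xc).
  rewrite labs_le; have [a0|/ltW a0] := leP 0 a.
    by rewrite ger0_norm// -scalerN !bl_leZ ?labs_ge ?labs_geN.
  rewrite ler0_norm// -[a *: x]opprK -scaleNr opprK -scalerN.
  by rewrite !bl_leZ ?labs_ge ?labs_geN// oppr_ge0.
- move=> x y x0 xy [c yc]; exists c; rewrite ger0_labs//.
  by apply: bl_trans (bl_trans xy (labs_ge y)) yc.
Qed.

Lemma unit_ideal_uniform (Omega : finType) h (u : Omega -> Y) : 0 <=L h ->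
  (forall w, unit_ideal h (u w)) ->
  exists2 c : R, 0 < c & forall w, u w <=L c *: h.
Proof.
move=> h0 Ku.
have /choice[c cP] w : exists c : R, 0 < c /\ labs (u w) <=L c *: h.
  by have [c c0 uc] := unit_ideal_pos h0 (Ku w); exists c.
exists (1 + \sum_w c w).
  by rewrite ltr_pwDl// sumr_ge0// => w _; have [/ltW] := cP w.
move=> w; apply: bl_trans (labs_ge _) _; have [c0 uc] := cP w.
apply: bl_trans uc _; apply: bl_leZl => //.
rewrite (bigD1 w)//= addrCA lerDl addr_ge0// sumr_ge0// => v _.
by have [/ltW] := cP v.
Qed.

Lemma principal_ideal_unit h z : 0 <=L h -> principal_ideal h z -> unit_ideal h z.
Proof.
by move=> h0 [m]; rewrite (ger0_labs h0) => zm; exists m%:R; rewrite scaler_nat.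
Qed.

End unit_ideal.

Lemma cvg_sum_seq (R : realType) (I : Type) (r : seq I) (F : I -> nat -> R) (l : I -> R) :
  (forall i, F i @ \oo --> l i) ->
  (fun k => \sum_(i <- r) F i k) @ \oo --> \sum_(i <- r) l i.
Proof. by move=> Fl; apply: cvg_big => //; exact: add_continuous. Qed.

Section discrete_facts.
Context (R : realType) (Y : banachLatticeType R) (Omega : finType) (n : nat).
Variable E : economy Y Omega n.
Implicit Types (i : 'I_n) (u v : Omega -> Y).

Lemma consumptionD i u v :
  consumption E i u -> consumption E i v -> consumption E i (u + v).
Proof.
move=> [u0 mu] [v0 mv]; split=> [w|A w w' AP wA w'A].
  by apply: bl_addr_ge0; [exact: u0|exact: v0].
by rewrite -[LHS]/(u w + v w) (mu _ _ _ AP wA w'A) (mv _ _ _ AP wA w'A).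
Qed.

Lemma consumptionZ i (c : R) u :
  0 <= c -> consumption E i u -> consumption E i (c *: u).
Proof.
move=> c0 [u0 mu]; split=> [w|A w w' AP wA w'A].
  by apply: bl_scale_ge0 => //; exact: u0.
by rewrite -[LHS]/(c *: u w) (mu _ _ _ AP wA w'A).
Qed.

Lemma consumption_cst i (y : Y) : 0 <=L y -> consumption E i (cst y).
Proof. by move=> y0; split. Qed.

Lemma exp_utility_mono i u (y : Y) (w0 : Omega) :
    (forall w x y, 0 <=L x -> 0 <L y -> utility E i w x < utility E i w (x + y)) ->
    (forall w, 0 <=L u w) -> 0 <L y ->
  exp_utility E i u < exp_utility E i (u + cst y).
Proof.
move=> mono u0 y0.
have lt w : utility E i w (u w) * prior E i w <
    utility E i w ((u + cst y) w) * prior E i w.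
  by rewrite ltr_pM2r ?prior_gt0//; exact: mono.
rewrite /exp_utility (bigD1 w0)//= [ltRHS](bigD1 w0)//=.
by apply: ltr_leD => //; apply: ler_sum => w _; exact: ltW.
Qed.

Lemma preferred_shrink i u v :
    (forall w, {within (@pos_cone R Y), continuous (utility E i w)}) ->
    preferred E i u v ->
  exists c : R, [/\ 0 <= c, c < 1 & preferred E i u (c *: v)].
Proof.
move=> cont [cv uv].
have h1 k : 0 <= 1 - harmonic k :> R.
  by rewrite subr_ge0 /harmonic invf_le1// ler1n.
have cvgU : (fun k => exp_utility E i ((1 - harmonic k) *: v)) @ \oo -->
    exp_utility E i v.
  rewrite /exp_utility; apply: cvg_sum_seq => w; apply: cvgMr_tmp.
  have /subspace_continuousP/(_ (v w) (cv.1 w)) cw := cont w.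
  apply: cvg_comp cw => B /= nB.
  have gv : (1 - harmonic k) *: v w @[k --> \oo] --> v w.
    rewrite -[X in _ --> X]scale1r; apply: cvgZr_tmp; rewrite -[X in _ --> X]subr0.
    by apply: cvgB; [exact: cvg_cst|exact: cvg_harmonic].
  have gB : \forall k \near \oo, pos_cone ((1 - harmonic k) *: v w) ->
    B ((1 - harmonic k) *: v w) := gv _ nB.
  suff : \forall k \near \oo, B ((1 - harmonic k) *: v w) by [].
  apply: filterS gB => k; apply.
  by rewrite /pos_cone /=; apply: bl_scale_ge0; [exact: h1|exact: (cv.1 w)].
have gtU : \forall k \near \oo,
    exp_utility E i u < exp_utility E i ((1 - harmonic k) *: v) by exact: cvgr_gt uv.
have [k ltk] := filter_ex gtU.
exists (1 - harmonic k); split.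
- exact: h1.
- by rewrite gtrBl /harmonic invr_gt0.
- by split=> //; apply: consumptionZ.
Qed.

Lemma price_valueD pi u v :
  price_value pi (u + v) = price_value (Y := Y) pi u + price_value pi v.
Proof. by rewrite /price_value -big_split; apply: eq_bigr => w _; rewrite linearD. Qed.

Lemma price_valueZ pi (c : R) u : price_value pi (c *: u) = c * price_value (Y := Y) pi u.
Proof. by rewrite /price_value mulr_sumr; apply: eq_bigr => w _; rewrite linearZ. Qed.

Lemma price_value_sum (I : finType) pi (u : I -> Omega -> Y) :
  price_value pi (\sum_i u i) = \sum_i price_value pi (u i).
Proof.
apply: (big_morph (price_value pi)); first exact: price_valueD.
by rewrite -(scale0r 0) price_valueZ mul0r.
Qed.

End discrete_facts.

(** * The theorem *)

Unset Implicit Arguments.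
Set Strict Implicit.
Set Printing Implicit Defensive.

Theorem theorem3p10 (R : realType) (Y : banachLatticeType R) (Omega : finType)
    (n : nat) (n_gt0 : (0 < n)%N) (E : economy Y Omega n)
    (continuity : forall i w,
       {within (@pos_cone R Y), continuous (utility E i w)})
    (monotonicity : forall i w (x y : Y), 0 <=L x -> 0 <L y ->
       utility E i w x < utility E i w (x + y))
    (concavity : forall i w (x y : Y) (l : R), 0 <=L x -> 0 <=L y ->
       0 <= l -> l <= 1 ->
       l * utility E i w x + (1 - l) * utility E i w y <=
       utility E i w (l *: x + (1 - l) *: y))
    (positivity : forall w, 0 <L aggregate_endow E w)
    (stability : exists2 ahat : Y, 0 <=L ahat &
       forall w, principal_ideal (aggregate_endow E w) = principal_ideal ahat)
    (strong_properness : forall x : 'I_n -> Omega -> Y,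
       privately_pareto_optimal E x ->
       forall i, strongly_ATY_proper E i (x i))
    (f : R -> Omega -> Y) (x : 'I_n -> Omega -> Y)
    (f_feasible : cont_feasible E f)
    (f_type : forall i t, agents_of i t -> f t = x i)
    (f_core : private_core E f) :
  exists pi : Omega -> {linear Y -> R^o},
    nontrivial_quasi_equilibrium E f pi.
Proof.
have P_unblocked (l : 'I_n -> R) y :=
  @core_unblocked R Y Omega n n_gt0 E f x f_type l y f_core.
have [x_cons x_feas] := type_allocation_feasible n_gt0 f_type f_feasible.
have [w0 _] : exists w0 : Omega, True.
  have := prior_sum1 E (Ordinal n_gt0).
  case: (pickP Omega) => [w _|no]; first by exists w.
  by rewrite big1 => [/esym/eqP|w]; [rewrite oner_eq0|have := no w].
have e_ge0 w : 0 <=L aggregate_endow E w by have /andP[] := positivity w.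
have [h h0 hL] := stability.
have h_pos : 0 <L h.
  rewrite h0 /= eq_sym; apply: contraTneq (positivity w0) => h00.
  have : principal_ideal h (aggregate_endow E w0).
    by rewrite -(hL w0); exists 1%N; rewrite mulr1n bl_le_refl.
  move=> [m]; rewrite h00 !ger0_labs ?bl_le_refl// mul0rn => le0.
  by rewrite (@bl_le_anti _ _ (aggregate_endow E w0) 0) ?eqxx ?andbF// le0 e_ge0.
pose J := unit_ideal h.
pose K : set (Omega -> Y) := [set u | forall w, J (u w)].
have J_ideal : order_ideal J := unit_ideal_order_ideal h0.
have [J0 JD JZ Jle] := J_ideal.
have Je w : J (aggregate_endow E w).
  apply: principal_ideal_unit => //; rewrite -(hL w).
  by exists 1%N; rewrite mulr1n bl_le_refl.
have KD u v : K u -> K v -> K (u + v) by move=> Ku Kv w; apply: JD.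
have KZ (c : R) u : K u -> K (c *: u) by move=> Ku w; apply: JZ.
have Kh : K (cst h) by move=> w; exists 1; rewrite scale1r ger0_labs ?bl_le_refl.
have Ka i : K (endow E i).
  move=> w; apply: Jle (endow_ge0 E i w) _ (Je w).
  by apply: (bl_le_sum (F := fun i => endow E i w)) => j; exact: endow_ge0.
have Kx i : K (x i).
  move=> w; apply: Jle ((x_cons i).1 w) _ (Je w); apply: bl_trans (x_feas w).
  by apply: (bl_le_sum (F := fun i => x i w)) => j; exact: (x_cons j).1.
have h_le_e w : exists2 c : R, 0 < c & h <=L c *: aggregate_endow E w.
  have [c c0 hc] : exists2 c : R, 0 < c & labs h <=L c *: aggregate_endow E w.
    apply: unit_ideal_pos => //; apply: principal_ideal_unit => //.
    by rewrite hL; exists 1%N; rewrite mulr1n bl_le_refl.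
  by exists c => //; rewrite -(ger0_labs h0).
have h_le_a : exists2 c : R, 0 < c & forall w, cst h w <=L c *: \sum_i endow E i w.
  have /choice[c cP] w : exists c : R, 0 < c /\ h <=L c *: aggregate_endow E w.
    by have [c c0 hc] := h_le_e w; exists c.
  exists (1 + \sum_w c w).
    by rewrite ltr_pwDl// sumr_ge0// => w _; have [/ltW] := cP w.
  move=> w; have [c0 hc] := cP w; apply: bl_trans hc _.
  apply: bl_leZl (e_ge0 w); rewrite (bigD1 w)//= addrCA lerDl addr_ge0//.
  by apply: sumr_ge0 => v _; have [/ltW] := cP v.
(* With unit weights, being unblocked is Pareto optimality. *)
have pareto : privately_pareto_optimal E x.
  split=> // -[y [[y_cons y_feas] y_better]].
  apply: (P_unblocked (fun=> 1) y) => // w.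
  rewrite (eq_bigr (fun i => y i w - endow E i w)) => [|i _]; last exact: scale1r.
  by rewrite sumrB -bl_oppr_ge0 opprB bl_subr_ge0; exact: y_feas.
have proper i := strong_properness x pareto i.
have P_convex i (s t : R) u v : 0 < s -> 0 < t -> s + t = 1 ->
    preferred E i (x i) u -> preferred E i (x i) v ->
    preferred E i (x i) (s *: u + t *: v).
  move=> s0 t0 st; have [Q [Qc _ <- _]] := proper i => -[Qu cu] [Qv cv].
  split; first exact: convex_setD.
  by apply: consumptionD; apply: consumptionZ => //; exact: ltW.
have P_mono i (c : R) : 0 < c -> preferred E i (x i) (x i + c *: cst h).
  move=> c0; have ch0 : 0 <L c *: h.
    rewrite bl_scale_ge0 ?(ltW c0)//= eq_sym scaler_eq0 gt_eqF//= eq_sym.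
    by have /andP[] := h_pos.
  have -> : c *: cst h = cst (c *: h) by [].
  split; first by apply: consumptionD => //; apply: consumption_cst; have /andP[] := ch0.
  by apply: exp_utility_mono => //; [move=> *; exact: monotonicity|exact: (x_cons i).1].
have h_unit u : K u -> exists2 c : R, 0 < c & forall w, u w <=L c *: cst h w.
  exact: unit_ideal_uniform.
have x_feas' w : \sum_i x i w <=L \sum_i endow E i w by exact: x_feas.
have [p [[pD pZ] p_ge0 px pP [p_sum p_gt0]]] :=
  supporting_functional KD KZ h_unit Kh Ka Kx x_feas' h_le_a P_convex P_mono P_unblocked.
have /choice[qM qMP] i : exists qM : ((Omega -> Y) -> R) * R,
  [/\ (forall u v, qM.1 (u + v) = qM.1 u + qM.1 v) /\
       (forall c u, qM.1 (c *: u) = c * qM.1 u),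
      0 <= qM.2 /\ (forall v r, 0 <= r -> (forall w, `|v w| <= r) -> qM.1 v <= qM.2 * r),
      forall u, preferred E i (x i) u -> p (x i) <= qM.1 u &
      forall u, K u -> consumption E i u -> qM.1 u <= p u].
  have [Q [Qc _ QP [z0 [[/nbhs_ptwsE[eps eps0 Qball] cz0] [m Kz0]]]]] := proper i.
  have Kz : K z0.
    move=> w; apply: (principal_ideal_unit h0); rewrite -(hL w).
    by exists m; exact: Kz0.
  have D0 : (consumption E i `&` K) 0.
    by split; [apply: consumption_cst; exact: bl_le_refl|move=> w].
  have [q [qL [M M0 qM] qQ qp]] : exists q : (Omega -> Y) -> R,
    [/\ (forall u v, q (u + v) = q u + q v) /\ (forall c u, q (c *: u) = c * q u),
      exists2 M : R, 0 <= M & forall v r, 0 <= r ->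
        (forall w, `|v w| <= r) -> q v <= M * r,
      forall z, Q z -> p (x i) <= q z &
      forall z, (consumption E i `&` K) z -> q z <= p z].
    apply: (@proper_support R Y Omega (consumption E i `&` K) Q p z0 eps) => //.
    - by move=> u v [cu Ku] [cv Kv]; split; [exact: consumptionD|exact: KD].
    - by move=> t u t0 [cu Ku]; split; [apply: consumptionZ => //; exact: ltW|exact: KZ].
    - by move=> u v [_ Ku] [_ Kv]; exact: pD.
    - by move=> t u _ [_ Ku]; exact: pZ.
    - by move=> s t u v s0 t0 st; exact: convex_setD.
    - by move=> z Qz [cz Kz']; rewrite px; apply: pP => //; rewrite -QP; split.
  exists (q, M); split=> //= u; last by move=> Ku cu; exact: qp.
  by rewrite -QP => -[Qu _]; exact: qQ.
pose q i := (qM i).1; pose M i := (qM i).2.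
(* x i + c h lies in Q for every c > 0, so q i (x i) >= p (x i) in the limit. *)
have qx i : q i (x i) = p (x i).
  have [[qD qZ] _ qP qp] := qMP i.
  apply/eqP; rewrite eq_le qp//=; apply/ler_addgt0Pr => r r0.
  pose c := r / (1 + `|q i (cst h)|).
  have d0 : 0 < 1 + `|q i (cst h)| by rewrite ltr_pwDl.
  have c0 : 0 < c by rewrite divr_gt0.
  have := qP _ (P_mono i c c0); rewrite qD qZ => /le_trans; apply; rewrite lerD2l.
  rewrite /c mulrAC ler_pdivrMr// ler_pM2l//.
  by apply: le_trans (ler_norm _) _; rewrite lerDr.
have e_unit w z : J z -> exists2 c : R, 0 < c & z <=L c *: aggregate_endow E w.
  move=> Jz; have [c c0 zc] := unit_ideal_pos h0 Jz; have [d d0 hd] := h_le_e w.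
  exists (c * d); first exact: mulr_gt0.
  rewrite -scalerA; apply: bl_trans (labs_ge z) _; apply: bl_trans zc _.
  by apply: bl_leZ => //; exact: ltW.
have sum_endow : \sum_i endow E i = aggregate_endow E.
  by apply/funext => w; rewrite fct_sumE.
have x_value : p (\sum_i x i) = p (aggregate_endow E) by rewrite p_sum sum_endow.
have [pi [pi_dual pi_p pi_q]] := @price_extension R Y Omega 'I_n J (info E)
  (aggregate_endow E) x p q M (info_partition E) J_ideal e_unit Je pD pZ p_ge0
  (fun i => (x_cons i).1) (fun i => (x_cons i).2) x_feas x_value
  (fun i => (let: And4 a _ _ _ := qMP i in a).1)
  (fun i => (let: And4 a _ _ _ := qMP i in a).2)
  (fun i => (let: And4 _ a _ _ := qMP i in a).1)
  (fun i => (let: And4 _ a _ _ := qMP i in a).2)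
  (fun i u Ku u0 mu => (let: And4 _ _ _ a := qMP i in a) u Ku (conj u0 mu)) qx.
have pi_x i : price_value pi (x i) = p (x i) by exact: pi_p _ (Kx i) (x_cons i).1.
have pi_a i : price_value pi (endow E i) = p (x i).
  by rewrite px; exact: pi_p _ (Ka i) (endow_ge0 E i).
have pi_sum_a : price_value pi (\sum_i endow E i) = p (\sum_i endow E i).
  by rewrite sum_endow; exact: pi_p _ Je e_ge0.
(* A better bundle u in the budget set could be shrunk to a better one of value
   less than that of the endowment. *)
have pi_demand i u : budget E pi i u -> price_value pi (endow E i) != 0 ->
    exp_utility E i u <= exp_utility E i (x i).
  move=> [cu ub] a0; rewrite leNgt; apply/negP => lt.
  have [c [c0 c1 [cv Pv]]] := preferred_shrink (continuity i) (conj cu lt).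
  have [_ _ qP _] := qMP i.
  have := le_trans (qP _ (conj cv Pv)) (pi_q i _ cv.1 cv.2).
  rewrite price_valueZ -pi_a; apply/negP; rewrite -ltNge.
  have a_gt0 : 0 < price_value pi (endow E i).
    rewrite lt_neqAle eq_sym a0 /= /price_value sumr_ge0// => w _.
    by have [_] := pi_dual w; apply; exact: endow_ge0.
  apply: (@le_lt_trans _ _ (c * price_value pi (endow E i))).
    exact: ler_wpM2l.
  by rewrite gtr_pMl.
exists pi; split; first split; first exact: f_feasible.
- split=> //; apply: contrapT => no; move: p_gt0; rewrite -pi_sum_a /price_value.
  rewrite big1 ?ltxx// => w _; apply/eqP; apply: contrapT => /negP nz.
  by apply: no; exists w, ((\sum_i endow E i) w).
- move=> t /(agents_of_cover n_gt0)[i it]; rewrite (f_type i t it).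
  have -> : cont_endow E t = endow E i by exact: (type_funE n_gt0 (endow E) it).
  split; first by apply/(cont_budgetE n_gt0 _ _ _ it); split; rewrite ?pi_x ?pi_a.
  move=> a0 u /(cont_budgetE n_gt0 _ _ _ it) bu.
  by rewrite !(cont_utilityE n_gt0 _ _ it); exact: pi_demand.
- have E1 (g : R -> Omega -> Y) (y : 'I_n -> Omega -> Y) :
      (forall i t, agents_of i t -> g t = y i) ->
      price_value pi (fun w =>
        bochner_integral lebesgue_measure (agent_space (R := R)) (g ^~ w)) =
      n%:R^-1 * \sum_i price_value pi (y i).
    move=> gy; rewrite -price_value_sum -price_valueZ; congr price_value.
    apply/funext => w; rewrite (integral_agent_space n_gt0 w gy).
    by rewrite -[RHS]/(_ *: (\sum_i y i) w) fct_sumE.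
  apply: etrans (E1 f x f_type) _; apply/esym.
  apply: etrans (E1 (cont_endow E) (endow E) _) _.
    by move=> i t it; exact: (type_funE n_gt0 (endow E) it).
  by congr (_ * _); apply: eq_bigr => i _; rewrite pi_x pi_a.
- have [i ai] : exists i, price_value pi (endow E i) != 0.
    apply: contrapT => no; move: p_gt0; rewrite -pi_sum_a price_value_sum.
    rewrite big1 ?ltxx// => i _; apply/eqP; apply: contrapT => /negP nz.
    by apply: no; exists i.
  exists (agents_of i).
    split; [exact: measurable_agents_of|exact: agents_of_sub|].
    by rewrite measure_agents_of// lte_fin invr_gt0 ltr0n.
  move=> t it.
  have -> : cont_endow E t = endow E i by exact: (type_funE n_gt0 (endow E) it).
  exact: ai.
Qed.
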